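(* Let $\mathcal V$ be a complex vector space, $\Omega\subseteq\mathcal V_{\mathrm{nc}}$ a finitely open nc set, $\mathcal W$ a complex Banach space with an admissible system of matrix norms, and $f:\Omega\to\mathcal W_{\mathrm{nc}}$ a nc function which is locally bounded on slices. Then: (1) $f$ is G-differentiable. (2) For every $n$, $Y\in\Omega_n$, $Z\in\mathcal V^{n\times n}$ and $N\in\mathbb N$, $t\mapsto f(Y+tZ)$ is $N$ times differentiable at $t=0$ and $\frac1{N!}\frac{d^N}{dt^N}f(Y+tZ)\big|_{t=0}=\Delta_R^Nf(Y,\dots,Y)(Z,\dots,Z)$ ($N+1$ copies of $Y$, $N$ copies of $Z$). (3) For $n\in\mathbb N$ and $Y\in\Omega_n$, let $\Upsilon(Y)=\{X\in\Omega_n:Y+t(X-Y)\in\Omega_n\text{ for all }t\in\mathbb C,|t|\le1\}$. Then $\Upsilon(Y)$ is the maximal complete circular set about $Y$ contained in $\Omega_n$ and is finitely open, and for every $X\in\Upsilon(Y)$, $$f(X)=\sum_{\ell=0}^\infty\Delta_R^\ell f(\underbrace{Y,\dots,Y}_{\ell+1})(\underbrace{X-Y,\dots,X-Y}_{\ell}),$$ with the series converging absolutely. (4) This series converges uniformly on compact subsets of $\mathcal U\cap\Upsilon(Y)$ for every finite-dimensional subspace $\mathcal U$ of $\mathcal V^{n\times n}$; moreover for every such compact set $K$ there exists a finitely open complete circular set $\Upsilon_K$ about $Y$ with $K\subseteq\Upsilon_K\subseteq\Upsilon(Y)$ and $\sum_{\ell=0}^\infty\sup_{X\in\Upsilon_K}\|\Delta_R^\ell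 f(Y,\dots,Y)(X-Y,\dots,X-Y)\|_n<\infty$.
   Context: $\mathcal V_{\mathrm{nc}}=\coprod_n\mathcal V^{n\times n}$; complex matrices act on matrices over $\mathcal V,\mathcal W$ by multiplication; $X\oplus Y=\begin{bmatrix}X&0\\0&Y\end{bmatrix}$. A nc set is a subset closed under direct sums, $\Omega_n=\Omega\cap\mathcal V^{n\times n}$; a nc function $f$ satisfies $f(\Omega_n)\subseteq\mathcal W^{n\times n}$, $f(X\oplus Y)=f(X)\oplus f(Y)$, $f(SXS^{-1})=Sf(X)S^{-1}$ for invertible $S\in\mathbb C^{n\times n}$ with $X,SXS^{-1}\in\Omega_n$. $\Omega$ is finitely open if each $\Omega_n$ meets every finite-dimensional subspace $\mathcal U\subseteq\mathcal V^{n\times n}$ in a Euclidean-open subset of $\mathcal U$. An admissible system of matrix norms over $\mathcal W$ is a sequence of norms $\|\cdot\|_n$ on $\mathcal W^{n\times n}$ such that there are constants $C_1(n,m),C_1'(n,m),C_2(n)>0$ with $C_1(n,m)^{-1}\max\{\|X\|_n,\|Y\|_m\}\le\|X\oplus Y\|_{n+m}\le C_1'(n,m)\max\{\|X\|_n,\|Y\|_m\}$ and $\|SXT\|_n\le C_2(n)\|S\|\|X\|_n\|T\|$ for $S,T\in\mathbb C^{n\times n}$ (operator norms). $f$ is locally bounded on slices if for every $n$, $X\in\Omega_n$, $Z\in\mathcal V^{n\times n}$ there is $\epsilon>0$ with $f(X+tZ)$ bounded for $|t|<\epsilon$; $f$ is G-differentiable if for all $n$, $X\in\Omega_n$, $Z\in\mathcal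 V^{n\times n}$ the limit $\lim_{t\to0}(f(X+tZ)-f(X))/t$ exists in $\mathcal W^{n\times n}$. A set $\Upsilon$ in a vector space is complete circular about $Y$ if $X\in\Upsilon$ implies $Y+t(X-Y)\in\Upsilon$ for all $|t|\le1$. A finitely open nc set is right admissible, so higher order operators are defined: with $\tilde\Omega=\{SXS^{-1}\}$ and $\tilde f(SXS^{-1})=Sf(X)S^{-1}$ the unique nc extension, for $X^j\in\Omega_{n_j}$ and $Z^j\in\mathcal V^{n_{j-1}\times n_j}$ the block upper bidiagonal matrix $B$ with diagonal $X^0,\dots,X^\ell$ and superdiagonal $Z^1,\dots,Z^\ell$ lies in $\tilde\Omega$, and $\Delta_R^\ell f(X^0,\dots,X^\ell)(Z^1,\dots,Z^\ell)$ is the $(1,\ell+1)$ block of $\tilde f(B)$ (multilinear; $\Delta_R^0f=f$). *)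

(* Defs.v *)
From HB Require Import structures.
From mathcomp Require Import all_boot all_order all_algebra.
From mathcomp Require Import complex.
From mathcomp Require Import all_classical all_reals all_analysis.
Set Implicit Arguments.
Unset Strict Implicit.
Unset Printing Implicit Defensive.
Import Order.TTheory GRing.Theory Num.Theory.
Import numFieldNormedType.Exports.
Local Open Scope ring_scope.
Local Open Scope classical_set_scope.

Section NC.
Context {R : realType}.
Local Notation C := (R[i]).

Definition cabs (z : C) : R := Normc.normc z.

(* norm of a vector of a complex normed space, as a real number
   (the library norm of a normedModType over C is C-valued, with zero
   imaginary part) *)
Definition wabs {W : normedModType C} (w : W) : R := complex.Re `|w|.

Definition lmx {V : lmodType C} {m n p : nat} (S : 'M[C]_(m, n))
  (X : 'M[V]_(n, p)) : 'M[V]_(m, p) :=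
  \matrix_(i, j) \sum_(k < n) S i k *: X k j.
Definition rmx {V : lmodType C} {m n p : nat} (X : 'M[V]_(m, n))
  (T : 'M[C]_(n, p)) : 'M[V]_(m, p) :=
  \matrix_(i, j) \sum_(k < n) T k j *: X i k.
Definition scmx {V : lmodType C} {m n : nat} (c : C) (X : 'M[V]_(m, n))
  : 'M[V]_(m, n) := map_mx ( *:%R c) X.
Definition dsum {V : lmodType C} {n m : nat} (X : 'M[V]_n) (Y : 'M[V]_m)
  : 'M[V]_(n + m) := block_mx X 0 0 Y.
Definition simil {V : lmodType C} {n : nat} (S : 'M[C]_n) (X : 'M[V]_n)
  : 'M[V]_n := lmx S (rmx X (invmx S)).

Definition vnorm {n : nat} (v : 'cV[C]_n) : R :=
  Num.sqrt (\sum_(i < n) cabs (v i 0) ^+ 2).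
Definition opnorm {n : nat} (S : 'M[C]_n) : R :=
  sup [set vnorm (S *m v) | v in [set v : 'cV[C]_n | vnorm v <= 1]].

Definition lincomb {V : lmodType C} {n k : nat} (c : 'rV[C^o]_k)
  (Zs : 'I_k -> 'M[V]_n) : 'M[V]_n :=
  \sum_(i < k) scmx (c 0 i) (Zs i).

(* U meets every finite-dimensional subspace of V^{n x n} in a relatively
   (Euclidean-)open set: for every finite family Z_1..Z_k, the set of
   coefficient vectors c in C^k with  sum c_i Z_i \in U  is open in C^k. *)
Definition fin_open_set {V : lmodType C} {n : nat} (U : set 'M[V]_n) :=
  forall (k : nat) (Zs : 'I_k -> 'M[V]_n),
    open [set c : 'rV[C^o]_k | U (lincomb c Zs)].

Section NCsets.
Context {V : lmodType C} {W : normedModType C}.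

Definition nc_set (Om : forall n, set 'M[V]_n) :=
  forall n m (X : 'M[V]_n) (Y : 'M[V]_m), Om n X -> Om m Y ->
    Om (n + m)%N (dsum X Y).

Definition fin_open (Om : forall n, set 'M[V]_n) :=
  forall n, fin_open_set (Om n).

Definition nc_fun (Om : forall n, set 'M[V]_n)
  (f : forall n, 'M[V]_n -> 'M[W]_n) :=
  (forall n m (X : 'M[V]_n) (Y : 'M[V]_m), Om n X -> Om m Y ->
     f (n + m)%N (dsum X Y) = dsum (f n X) (f m Y)) /\
  (forall n (X : 'M[V]_n) (S : 'M[C]_n), S \in unitmx ->
     Om n X -> Om n (simil S X) -> f n (simil S X) = simil S (f n X)).

Definition admissible (nrm : forall n, 'M[W]_n -> R) :=
  [/\ (forall n, [/\ forall X, 0 <= nrm n X,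
                   forall X, nrm n X = 0 -> X = 0,
                   forall (c : C) X, nrm n (scmx c X) = cabs c * nrm n X
                 & forall X Y, nrm n (X + Y) <= nrm n X + nrm n Y]),
      (exists2 a : R, 0 < a & exists2 b : R, 0 < b &
         forall X : 'M[W]_1, a * wabs (X 0 0) <= nrm 1%N X <= b * wabs (X 0 0)),
      (forall n m, exists2 c1 : R, 0 < c1 & exists2 c1' : R, 0 < c1' &
         forall (X : 'M[W]_n) (Y : 'M[W]_m),
           c1^-1 * Num.max (nrm n X) (nrm m Y) <= nrm (n + m)%N (dsum X Y)
           <= c1' * Num.max (nrm n X) (nrm m Y))
    & (forall n, exists2 c2 : R, 0 < c2 &
         forall (S T : 'M[C]_n) (X : 'M[W]_n),
           nrm n (lmx S (rmx X T)) <= c2 * opnorm S * nrm n X * opnorm T)].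

Definition mlim {n : nat} (N : 'M[W]_n -> R) (g : C -> 'M[W]_n)
  (L : 'M[W]_n) :=
  forall eps : R, 0 < eps -> exists2 d : R, 0 < d &
    forall t : C, 0 < cabs t < d -> N (g t - L) < eps.

Definition has_deriv {n : nat} (N : 'M[W]_n -> R) (g : C -> 'M[W]_n)
  (t0 : C) (d : 'M[W]_n) :=
  mlim N (fun h => scmx h^-1 (g (t0 + h) - g t0)) d.

(* g is k times (complex-)differentiable at t0 with k-th derivative d:
   derivatives D 0 = g, D 1, ..., D (k-1) exist on a disc around t0 and
   D (k-1) is differentiable at t0 with derivative D k t0 = d. *)
Definition nth_deriv_at {n : nat} (N : 'M[W]_n -> R) (g : C -> 'M[W]_n)
  (k : nat) (t0 : C) (d : 'M[W]_n) :=
  exists D : nat -> C -> 'M[W]_n,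
    [/\ forall t, D 0%N t = g t,
        exists2 r : R, 0 < r & forall (j : nat) (t : C), (j.+1 < k)%N ->
          cabs (t - t0) < r -> has_deriv N (D j) t (D j.+1 t),
        (0 < k)%N -> has_deriv N (D k.-1) t0 (D k t0)
      & D k t0 = d].

Definition G_diff (Om : forall n, set 'M[V]_n) (nrm : forall n, 'M[W]_n -> R)
  (f : forall n, 'M[V]_n -> 'M[W]_n) :=
  forall n (X Z : 'M[V]_n), Om n X -> exists L : 'M[W]_n,
    mlim (nrm n) (fun t => scmx t^-1 (f n (X + scmx t Z) - f n X)) L.

Definition loc_bdd_slices (Om : forall n, set 'M[V]_n)
  (nrm : forall n, 'M[W]_n -> R) (f : forall n, 'M[V]_n -> 'M[W]_n) :=
  forall n (X Z : 'M[V]_n), Om n X -> exists2 eps : R, 0 < eps &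
    exists M : R, forall t : C, cabs t < eps -> Om n (X + scmx t Z) ->
      nrm n (f n (X + scmx t Z)) <= M.

(* the unique nc extension  f~(S X S^{-1}) = S f(X) S^{-1}  to the
   similarity envelope of Om (value chosen by choice; junk 0 outside) *)
Definition ncext (Om : forall n, set 'M[V]_n)
  (f : forall n, 'M[V]_n -> 'M[W]_n) (N : nat) (B : 'M[V]_N) : 'M[W]_N :=
  xget 0 [set Wv : 'M[W]_N | exists (S : 'M[C]_N) (X : 'M[V]_N),
    [/\ S \in unitmx, Om N X, B = simil S X & Wv = simil S (f N X)]].

Definition bidiag {n : nat} (Y Z : 'M[V]_n) (l : nat)
  : 'M[V]_(\sum_(i < l.+1) n) :=
  @mxblock V l.+1 l.+1 (fun=> n) (fun=> n)
    (fun i j => if i == j then Y else if (j == i.+1 :> nat) then Z else 0).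

(* Delta_R^l f (Y, ..., Y) (Z, ..., Z)  ((l+1) Y's, l Z's) :
   the (1, l+1) block of f~ (bidiag Y Z l) *)
Definition DeltaR (Om : forall n, set 'M[V]_n)
  (f : forall n, 'M[V]_n -> 'M[W]_n) {n : nat} (Y Z : 'M[V]_n) (l : nat)
  : 'M[W]_n :=
  @submxblock W l.+1 l.+1 (fun=> n) (fun=> n)
    (ncext Om f (bidiag Y Z l)) ord0 ord_max.

Definition compl_circ {n : nat} (Y : 'M[V]_n) (U : set 'M[V]_n) :=
  forall X, U X -> forall t : C, cabs t <= 1 -> U (Y + scmx t (X - Y)).

Definition Ups (Om : forall n, set 'M[V]_n) {n : nat} (Y : 'M[V]_n)
  : set 'M[V]_n :=
  [set X | Om n X /\ forall t : C, cabs t <= 1 -> Om n (Y + scmx t (X - Y))].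

Definition series_to {n : nat} (N : 'M[W]_n -> R) (u : nat -> 'M[W]_n)
  (s : 'M[W]_n) :=
  forall eps : R, 0 < eps -> exists N0 : nat, forall M : nat, (N0 <= M)%N ->
    N (\sum_(l < M) u l - s) < eps.

Definition series_unif_to {n : nat} (N : 'M[W]_n -> R)
  (u : nat -> 'M[V]_n -> 'M[W]_n) (s : 'M[V]_n -> 'M[W]_n)
  (K : set 'M[V]_n) :=
  forall eps : R, 0 < eps -> exists N0 : nat, forall M : nat, (N0 <= M)%N ->
    forall X, K X -> N (\sum_(l < M) u l X - s X) < eps.

End NCsets.
End NC.

(* Main.v *)
Require Import Defs.
From HB Require Import structures.
From mathcomp Require Import all_boot all_order all_algebra.
From mathcomp Require Import complex.
From mathcomp Require Import all_classical all_reals all_analysis.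
From mathcomp Require Import ring lra cyclic separable cyclotomic.
Import Order.TTheory GRing.Theory Num.Theory.
Import numFieldNormedType.Exports.
Set Implicit Arguments.
Unset Strict Implicit.
Unset Printing Implicit Defensive.
Local Open Scope ring_scope.
Local Open Scope classical_set_scope.

(** Since X T = T X' forces f(X) T = T f(X'), comparing the block bidiagonal
    matrix with diagonal Y, ..., Y, Y + tZ and superdiagonal eZ with the column
    of blocks (t/e)^i I gives
      f(Y + tZ) = sum_(l < N) t^l Delta^l f(Y,..,Y)(Z,..,Z) + O(t^N)
    for every N, the remainder being a block of f along a slice.  Thus
    g(t) = f(Y + tZ) has Peano expansions of all orders at every point.  This
    alone yields the maximum modulus principle for the norm of g (average over
    z +- h, z +- ih), hence, with means over roots of unity, the Cauchy
    estimates and the convergence of the Taylor series on discs; no contour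
    integration and no completeness of W is needed.  For several variables,
    Delta^l f(Y,..,Y)(Z,..,Z) is homogeneous and polynomial along complex lines
    in Z, hence continuous on finite-dimensional spaces; Baire's theorem and
    the maximum principle bound it near 0 uniformly in l, so f is continuous on
    finite-dimensional slices and compactness arguments conclude. *)

(** The hypotheses concern one complex line at a time, with a bound that depends on the line.
    Uniformity has to be won from the values of f at larger matrices. A small e keeps the bidiagonal
    matrix inside [Om], and moving its last diagonal block from Y to Y + tZ is itself a slice, of
    matrices N+1 times as large: a bound on that slice controls the corner block, and the last entry
    (t/e)^N of the column supplies the power of t. In the same way Delta^l at the direction Z + s Z0
    is, up to a scalar, a corner block of f on a slice in s. This makes the coefficients accessible
    to one-variable arguments in the direction too, where homogeneity and Liouville's theorem yield
    polynomials. The one-variable theory lives in a complex module with a norm function N and uses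
    expansions whose radius and constant vary from point to point without control; compactness of
    discs makes up for that. The series is evaluated at t = 1, on the edge of the disc given by
    [Ups]. Compactness enlarges this disc to radius 1 + s, and the ratio 1/(1 + s) then governs all
    convergence. *)

Arguments cabs : simpl never.

(** * Complex modulus and matrices over modules *)

Section Modulus.
Context {R : realType}.
Local Notation C := R[i].
Implicit Types z w : C.

Lemma cabs_ge0 z : 0 <= cabs z.
Proof. by case: z => a b; rewrite /cabs /= sqrtr_ge0. Qed.

Lemma cabs0 : cabs (0 : C) = 0. Proof. exact: Normc.normc0. Qed.

Lemma cabs1 : cabs (1 : C) = 1. Proof. exact: Normc.normc1. Qed.

Lemma cabsM z w : cabs (z * w) = cabs z * cabs w.
Proof. exact: Normc.normcM. Qed.

Lemma cabsV z : cabs z^-1 = (cabs z)^-1. Proof. exact: Normc.normcV. Qed.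

Lemma cabsX z n : cabs (z ^+ n) = cabs z ^+ n.
Proof. by elim: n => [|n IH]; rewrite ?cabs1 // !exprS cabsM IH. Qed.

Lemma cabsD z w : cabs (z + w) <= cabs z + cabs w.
Proof.
have := ler_normD z w; rewrite lecE => /andP[_].
by case: z w => [a b] [c d].
Qed.

Lemma cabsN z : cabs (- z) = cabs z.
Proof. by case: z => a b; rewrite /cabs /= !sqrrN. Qed.

Lemma cabs_distC z w : cabs (z - w) = cabs (w - z).
Proof. by rewrite -cabsN opprB. Qed.

Lemma cabs_eq0 z : (cabs z == 0) = (z == 0).
Proof.
apply/eqP/eqP => [/Normc.eq0_normc //|->]; exact: cabs0.
Qed.

Lemma cabs_gt0 z : (0 < cabs z) = (z != 0).
Proof. by rewrite lt_def cabs_ge0 cabs_eq0 andbT. Qed.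

Lemma cabs_real (x : R) : cabs x%:C%C = `|x|.
Proof. by rewrite /cabs /= expr0n /= addr0 sqrtr_sqr. Qed.

Lemma cabsE z : `|z| = (cabs z)%:C%C.
Proof. by case: z. Qed.

Lemma cabs_sqr z : cabs z ^+ 2 = complex.Re z ^+ 2 + complex.Im z ^+ 2.
Proof. by case: z => a b; rewrite /cabs /= sqr_sqrtr // addr_ge0 ?sqr_ge0. Qed.

Lemma cabs_nat n : cabs (n%:R : C) = n%:R.
Proof.
have -> : (n%:R : C) = (n%:R : R)%:C%C by rewrite rmorph_nat.
by rewrite cabs_real ger0_norm.
Qed.

End Modulus.

Section ModuleMatrices.
Context {R : realType}.
Local Notation C := R[i].

Section Actions.
Context {V : lmodType C}.

Lemma lmxA m n p q (S : 'M[C]_(m, n)) (T : 'M[C]_(n, p)) (X : 'M[V]_(p, q)) :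
  lmx (S *m T) X = lmx S (lmx T X).
Proof.
apply/matrixP => i j; rewrite !mxE.
under eq_bigr do rewrite mxE scaler_suml.
rewrite exchange_big; apply: eq_bigr => k _; rewrite mxE scaler_sumr.
by apply: eq_bigr => l _; rewrite scalerA.
Qed.

Lemma rmxA m n p q (X : 'M[V]_(m, n)) (S : 'M[C]_(n, p)) (T : 'M[C]_(p, q)) :
  rmx X (S *m T) = rmx (rmx X S) T.
Proof.
apply/matrixP => i j; rewrite !mxE.
under eq_bigr do rewrite mxE scaler_suml.
rewrite exchange_big; apply: eq_bigr => k _; rewrite mxE scaler_sumr.
by apply: eq_bigr => l _; rewrite scalerA mulrC.
Qed.

Lemma lmx_rmx m n p q (S : 'M[C]_(m, n)) (X : 'M[V]_(n, p)) (T : 'M[C]_(p, q)) :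
  lmx S (rmx X T) = rmx (lmx S X) T.
Proof.
apply/matrixP => i j; rewrite !mxE.
under eq_bigr do rewrite mxE scaler_sumr.
rewrite exchange_big; apply: eq_bigr => k _; rewrite mxE scaler_sumr.
by apply: eq_bigr => l _; rewrite !scalerA mulrC.
Qed.

Lemma lmx_scalar m n (c : C) (X : 'M[V]_(m, n)) : lmx c%:M X = scmx c X.
Proof.
apply/matrixP => i j; rewrite !mxE (bigD1 i) //= big1 ?addr0 => [|k /negbTE ki].
  by rewrite mxE eqxx.
by rewrite mxE eq_sym ki scale0r.
Qed.

Lemma rmx_scalar m n (c : C) (X : 'M[V]_(m, n)) : rmx X c%:M = scmx c X.
Proof.
apply/matrixP => i j; rewrite !mxE (bigD1 j) //= big1 ?addr0 => [|k /negbTE ki].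
  by rewrite mxE eqxx.
by rewrite mxE ki scale0r.
Qed.

Lemma scmx1 m n (X : 'M[V]_(m, n)) : scmx 1 X = X.
Proof. by apply/matrixP => i j; rewrite mxE scale1r. Qed.

Lemma lmx1 m n (X : 'M[V]_(m, n)) : lmx 1%:M X = X.
Proof. by rewrite lmx_scalar scmx1. Qed.

Lemma rmx1 m n (X : 'M[V]_(m, n)) : rmx X 1%:M = X.
Proof. by rewrite rmx_scalar scmx1. Qed.

Lemma lmx0l m n p (X : 'M[V]_(n, p)) : lmx (0 : 'M[C]_(m, n)) X = 0.
Proof. by apply/matrixP => i j; rewrite !mxE big1 // => k _; rewrite mxE scale0r. Qed.

Lemma lmx0r m n p (S : 'M[C]_(m, n)) : lmx S (0 : 'M[V]_(n, p)) = 0.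
Proof. by apply/matrixP => i j; rewrite !mxE big1 // => k _; rewrite mxE scaler0. Qed.

Lemma rmx0l m n p (S : 'M[C]_(n, p)) : rmx (0 : 'M[V]_(m, n)) S = 0.
Proof. by apply/matrixP => i j; rewrite !mxE big1 // => k _; rewrite mxE scaler0. Qed.

Lemma rmx0r m n p (X : 'M[V]_(m, n)) : rmx X (0 : 'M[C]_(n, p)) = 0.
Proof. by apply/matrixP => i j; rewrite !mxE big1 // => k _; rewrite mxE scale0r. Qed.

Lemma lmx_block m1 m2 n1 n2 p1 p2
    (A : 'M[C]_(m1, n1)) (B : 'M[C]_(m1, n2)) (D : 'M[C]_(m2, n1))
    (E : 'M[C]_(m2, n2)) (X : 'M[V]_(n1, p1)) (Y : 'M[V]_(n1, p2))
    (Z : 'M[V]_(n2, p1)) (T : 'M[V]_(n2, p2)) :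
  lmx (block_mx A B D E) (block_mx X Y Z T) =
  block_mx (lmx A X + lmx B Z) (lmx A Y + lmx B T)
           (lmx D X + lmx E Z) (lmx D Y + lmx E T).
Proof.
apply/matrixP => i j; rewrite [LHS]mxE big_split_ord /=.
case: (split_ordP i) => {}i ->; case: (split_ordP j) => {}j ->;
  rewrite ?(block_mxEul, block_mxEur, block_mxEdl, block_mxEdr) !mxE;
  congr (_ + _); apply: eq_bigr => k _;
  by rewrite ?(block_mxEul, block_mxEur, block_mxEdl, block_mxEdr).
Qed.

Lemma rmx_block m1 m2 n1 n2 p1 p2
    (X : 'M[V]_(m1, n1)) (Y : 'M[V]_(m1, n2)) (Z : 'M[V]_(m2, n1))
    (T : 'M[V]_(m2, n2)) (A : 'M[C]_(n1, p1)) (B : 'M[C]_(n1, p2))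
    (D : 'M[C]_(n2, p1)) (E : 'M[C]_(n2, p2)) :
  rmx (block_mx X Y Z T) (block_mx A B D E) =
  block_mx (rmx X A + rmx Y D) (rmx X B + rmx Y E)
           (rmx Z A + rmx T D) (rmx Z B + rmx T E).
Proof.
apply/matrixP => i j; rewrite [LHS]mxE big_split_ord /=.
case: (split_ordP i) => {}i ->; case: (split_ordP j) => {}j ->;
  rewrite ?(block_mxEul, block_mxEur, block_mxEdl, block_mxEdr) !mxE;
  congr (_ + _); apply: eq_bigr => k _;
  by rewrite ?(block_mxEul, block_mxEur, block_mxEdl, block_mxEdr).
Qed.

(** Recasts a similarity as an intertwining relation without inverses, which block computations can
    check entry by entry. *)
Lemma simil_eq n (S : 'M[C]_n) (X Y : 'M[V]_n) : S \in unitmx ->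
  lmx S X = rmx Y S -> simil S X = Y.
Proof. by move=> uS e; rewrite /simil lmx_rmx e -rmxA mulmxV // rmx1. Qed.

Lemma lmx_simil n (S : 'M[C]_n) (X : 'M[V]_n) : S \in unitmx ->
  rmx (simil S X) S = lmx S X.
Proof. by move=> uS; rewrite /simil lmx_rmx -rmxA mulVmx // rmx1. Qed.

End Actions.

(** * Intertwining and the extension to the similarity envelope *)

Section Intertwining.
Context {V : lmodType C} {W : normedModType C} (Om : forall n, set 'M[V]_n)
  (f : forall n, 'M[V]_n -> 'M[W]_n).
Hypothesis Om_nc : forall n m (X : 'M[V]_n) (Y : 'M[V]_m), Om X -> Om Y ->
    @Om (n + m)%N (dsum X Y).
Hypothesis f_dsum : forall n m (X : 'M[V]_n) (Y : 'M[V]_m), Om X -> Om Y ->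
     f (dsum X Y) = dsum (f X) (f Y).
Hypothesis f_simil : forall n (X : 'M[V]_n) (S : 'M[C]_n), S \in unitmx ->
     Om X -> Om (simil S X) -> f (simil S X) = simil S (f X).

(* X T = T X' says that [[1,T],[0,1]] commutes with X (+) X', hence with
   f X (+) f X'. *)
Lemma nc_intertwine n m (X : 'M[V]_n) (X' : 'M[V]_m) (T : 'M[C]_(n, m)) :
  Om X -> Om X' -> rmx X T = lmx T X' -> rmx (f X) T = lmx T (f X').
Proof.
move=> oX oX' XT; pose S := block_mx 1%:M T 0 1%:M : 'M[C]_(n + m).
have uS : S \in unitmx by rewrite unitmxE det_ublock !det1 mulr1 unitr1.
have eS : simil S (dsum X X') = dsum X X'.
  apply: simil_eq => //; rewrite /dsum lmx_block rmx_block.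
  by rewrite !lmx1 !rmx1 !lmx0l !lmx0r !rmx0l !rmx0r XT !addr0 !add0r.
have := f_simil uS (Om_nc oX oX'); rewrite eS => /(_ (Om_nc oX oX')).
move/(congr1 (fun F => rmx F S)); rewrite lmx_simil // f_dsum //.
rewrite /dsum lmx_block rmx_block !lmx1 !rmx1 !lmx0l !lmx0r !rmx0l !rmx0r.
by rewrite !addr0 !add0r => /eq_block_mx[].
Qed.

(** The value chosen by [xget] comes from some S' and X' with the same conjugate. Then S^-1 S'
    intertwines X and X', hence f X and f X', so both representations give the same value. *)
Lemma ncext_simil n (S : 'M[C]_n) (X : 'M[V]_n) : S \in unitmx -> Om X ->
  ncext Om f (simil S X) = simil S (f X).
Proof.
move=> uS oX; rewrite /ncext.
set P := (X in xget 0 X).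
have /xgetPex : exists y, P y by exists (simil S (f X)), S, X.
move=> /(_ 0) [S' [X' [uS' oX' e ->]]].
have := @nc_intertwine _ _ X X' (invmx S *m S') oX oX'.
have h : rmx X (invmx S *m S') = lmx (invmx S *m S') X'.
  by rewrite lmxA -[lmx S' X']lmx_simil // -e lmx_rmx /simil -lmxA mulVmx // lmx1 -rmxA.
move=> /(_ h) => {}h; apply/esym/simil_eq => //.
have vS : S *m (invmx S *m S') = S' by rewrite mulmxA mulmxV // mul1mx.
have -> : f X = rmx (lmx (invmx S *m S') (f X')) (invmx S' *m S).
  by rewrite -h -rmxA mulmxA -(mulmxA (invmx S)) mulmxV // mulmx1 mulVmx // rmx1.
by rewrite /simil -lmx_rmx -lmxA vS rmxA lmx_rmx.
Qed.

End Intertwining.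

(** * Block matrices with square blocks of one size *)

Section Blocks.
Context {T : Type}.
(** With the size family fixed to [fun=> n], these unfold to the terms inside [bidiag] and [DeltaR],
    so that one passes between the two by conversion. *)
Definition blockmx p q n (B : 'I_p -> 'I_q -> 'M[T]_n) :
    'M[T]_(\sum_(i < p) n, \sum_(j < q) n) :=
  @mxblock T p q (fun=> n) (fun=> n) B.

Definition blockof p q n (A : 'M[T]_(\sum_(i < p) n, \sum_(j < q) n))
    (i : 'I_p) (j : 'I_q) : 'M[T]_n :=
  @submxblock T p q (fun=> n) (fun=> n) A i j.

Lemma blockofE p q n (A : 'M[T]_(\sum_(i < p) n, \sum_(j < q) n)) i j a b :
  blockof A i j a b =
  A (@tagnat.Rank p (fun=> n) i a) (@tagnat.Rank q (fun=> n) j b).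
Proof. by rewrite mxE. Qed.

Lemma blockmxK p q n (B : 'I_p -> 'I_q -> 'M[T]_n) i j :
  blockof (blockmx B) i j = B i j.
Proof. by rewrite /blockof /blockmx mxblockK. Qed.

Lemma blockofK p q n (A : 'M[T]_(\sum_(i < p) n, \sum_(j < q) n)) :
  blockmx (blockof A) = A.
Proof. exact: submxblockK. Qed.

Lemma eq_blockmx p q n (B B' : 'I_p -> 'I_q -> 'M[T]_n) :
  B =2 B' -> blockmx B = blockmx B'.
Proof. by move=> e; apply/matrixP => i j; rewrite !mxE e. Qed.
End Blocks.

Lemma sum_ord_blocks (M : nmodType) p n (F : 'I_(\sum_(i < p) n) -> M) :
  \sum_k F k = \sum_(i < p) \sum_(a < n) F (@tagnat.Rank p (fun=> n) i a).
Proof.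
rewrite sig_big_dep /= (reindex _ (@tagnat.sig_bij_on p (fun=> n))) /=.
by apply: eq_bigr => l _; rewrite -tagnat.rankE tagnat.sigK.
Qed.

(* s (x) I_n *)
Definition tensmx p q n (s : 'I_p -> 'I_q -> C) :=
  blockmx (fun i j => (s i j)%:M : 'M[C]_n).

Definition tenscol p n (s : 'I_p -> C) : 'M[C]_(\sum_(i < p) n, n) :=
  @mxcol C p (fun=> n) n (fun i => (s i)%:M).

Lemma tensmxE p q n (s : 'I_p -> 'I_q -> C) i j a b :
  tensmx n s (@tagnat.Rank p (fun=> n) i a) (@tagnat.Rank q (fun=> n) j b) =
  (s i j)%:M a b.
Proof. by rewrite -blockofE blockmxK. Qed.

Lemma tenscolE p n (s : 'I_p -> C) i a b :
  tenscol n s (@tagnat.Rank p (fun=> n) i a) b = (s i)%:M a b.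
Proof.
have := congr1 (fun M : 'M[C]_n => M a b)
  (@mxcolK C p (fun=> n) n (fun i => (s i)%:M : 'M[C]_n) i).
by rewrite mxE.
Qed.

Section Tensors.
Context {V : lmodType C}.

(** Reduces the verification of block intertwining relations to scalar sums over block indices. *)
Lemma lmx_tens p q r n (s : 'I_p -> 'I_q -> C)
    (A : 'M[V]_(\sum_(i < q) n, \sum_(i < r) n)) i k :
  blockof (lmx (tensmx n s) A) i k = \sum_j scmx (s i j) (blockof A j k).
Proof.
apply/matrixP => a b; rewrite blockofE mxE sum_ord_blocks summxE.
apply: eq_bigr => j _; rewrite -lmx_scalar mxE.
by apply: eq_bigr => c _; rewrite tensmxE blockofE.
Qed.

Lemma rmx_tens p q r n (A : 'M[V]_(\sum_(i < p) n, \sum_(i < q) n))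
    (s : 'I_q -> 'I_r -> C) i k :
  blockof (rmx A (tensmx n s)) i k = \sum_j scmx (s j k) (blockof A i j).
Proof.
apply/matrixP => a b; rewrite blockofE mxE sum_ord_blocks summxE.
apply: eq_bigr => j _; rewrite -rmx_scalar mxE.
by apply: eq_bigr => c _; rewrite tensmxE blockofE.
Qed.

Lemma rmx_tenscol p q n (A : 'M[V]_(\sum_(i < p) n, \sum_(i < q) n))
    (s : 'I_q -> C) i a b :
  rmx A (tenscol n s) (@tagnat.Rank p (fun=> n) i a) b =
  (\sum_j scmx (s j) (blockof A i j)) a b.
Proof.
rewrite mxE sum_ord_blocks summxE.
apply: eq_bigr => j _; rewrite -rmx_scalar mxE.
by apply: eq_bigr => c _; rewrite tenscolE blockofE.
Qed.

Lemma lmx_tenscol p n (s : 'I_p -> C) (X : 'M[V]_n) i a b :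
  lmx (tenscol n s) X (@tagnat.Rank p (fun=> n) i a) b = scmx (s i) X a b.
Proof.
by rewrite -lmx_scalar !mxE; apply: eq_bigr => c _; rewrite tenscolE.
Qed.

End Tensors.

Lemma blockof_inj (T : Type) p q n (A B : 'M[T]_(\sum_(i < p) n, \sum_(j < q) n)) :
  (forall i j, blockof A i j = blockof B i j) -> A = B.
Proof. by move=> e; rewrite -(blockofK A) -(blockofK B); exact: eq_blockmx. Qed.

Lemma tens_mul p q r n (s : 'I_p -> 'I_q -> C) (t : 'I_q -> 'I_r -> C) :
  tensmx n s *m tensmx n t = tensmx n (fun i k => \sum_j s i j * t j k).
Proof.
(* A product of complex matrices is the action on matrices over the module [C^o], so [lmx_tens]
   covers it. *)
have lmxE m1 m2 m3 (A : 'M[C]_(m1, m2)) (B : 'M[C]_(m2, m3)) :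
    A *m B = lmx A (B : 'M[C^o]_(m2, m3)).
  by apply/matrixP => i j; rewrite !mxE.
rewrite lmxE; apply: blockof_inj => i k; rewrite lmx_tens blockmxK.
rewrite raddf_sum /=; apply: eq_bigr => j _; rewrite blockmxK.
by apply/matrixP => a b; rewrite !mxE -mulrnAr.
Qed.

Lemma tens1 p n : tensmx n (fun i j : 'I_p => (i == j)%:R) = 1%:M.
Proof.
apply/matrixP => i j; rewrite !mxE -(inj_eq (@tagnat.sig_inj _ (fun=> n)) i j).
rewrite /tagnat.sig1 /tagnat.sig2.
case: (tagnat.sig i) (tagnat.sig j) => {}i a [{}j b] /=.
rewrite -tag_eqE /tag_eq /= ; case: eqVneq => /= [e|]; last by rewrite mul0rn.
by subst j; rewrite tagged_asE.
Qed.

(** One shape for all base points and directions in use: Y' = Y gives [bidiag], [tri Y Y 0] the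
    diagonal, [tri 0 0 Z] a superdiagonal direction, and [tri 0 Z 0] the direction that moves only
    the last diagonal block. *)
Definition tri (T : zmodType) n (Y Y' Z : 'M[T]_n) l :
    'M[T]_(\sum_(i < l.+1) n) :=
  blockmx (fun i j => if i == j then (if i == ord_max then Y' else Y)
    else if (j == i.+1 :> nat) then Z else 0).

Lemma bidiagE (V : lmodType C) n (Y Z : 'M[V]_n) l : bidiag Y Z l = tri Y Y Z l.
Proof. by apply: eq_blockmx => i j; rewrite if_same. Qed.

End ModuleMatrices.

(** * Finitely open sets and the Taylor-Taylor expansion *)

Section CoordinateTopology.
Context {R : realType}.
Local Notation C := R[i].

(** Balls over [C^o] have radii in [C]; a positive one has zero imaginary part, so real radii
    suffice. *)
Lemma nbhs_rVP k (c : 'rV[C^o]_k) (A : set 'rV[C^o]_k) :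
  nbhs c A <-> exists2 d : R, 0 < d &
    forall c' : 'rV[C^o]_k, (forall i, cabs (c' 0 i - c 0 i) < d) -> A c'.
Proof.
split=> [/nbhs_ballP[e e0 eA]|[d d0 dA]].
  move: e0; rewrite /= ltcE /= => /andP[/eqP e2 e1].
  exists (complex.Re e) => // c' c'c; apply: eA; split.
    by rewrite ltcE e2 eqxx.
  move=> i j; rewrite (ord1 i) /ball /= cabsE ltcE /= e2 eqxx /=.
  by rewrite cabs_distC; exact: c'c.
apply/nbhs_ballP; exists (d%:C)%C; first by rewrite /= ltcR.
move=> c' [_ cc']; apply: dA => i; have := cc' 0 i.
by rewrite /ball /= cabsE ltcR cabs_distC.
Qed.

Lemma nbhs_CP (z : C^o) (A : set C^o) :
  nbhs z A <-> exists2 d : R, 0 < d & forall w : C, cabs (w - z) < d -> A w.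
Proof.
split=> [/nbhs_ballP[e e0 eA]|[d d0 dA]].
  move: e0; rewrite /= ltcE /= => /andP[/eqP e2 e1].
  exists (complex.Re e) => // c' c'c; apply: eA.
  rewrite /ball /= cabsE ltcE /= e2 eqxx /=.
  by rewrite cabs_distC; exact: c'c.
apply/nbhs_ballP; exists (d%:C)%C; first by rewrite /= ltcR.
move=> c' cc'; apply: dA; move: cc'.
by rewrite /ball /= cabsE ltcR cabs_distC.
Qed.

Lemma open_rVP k (A : set 'rV[C^o]_k) :
  open A <-> forall c, A c -> exists2 d : R, 0 < d &
    forall c' : 'rV[C^o]_k, (forall i, cabs (c' 0 i - c 0 i) < d) -> A c'.
Proof.
rewrite openE; split=> h c /h; first by move=> /nbhs_rVP.
by move=> hc; apply/nbhs_rVP.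
Qed.

End CoordinateTopology.

Section Families.
Context {R : realType} {V : lmodType R[i]}.
Local Notation C := R[i].

Lemma scmxD m n (c : C) (X Y : 'M[V]_(m, n)) :
  scmx c (X + Y) = scmx c X + scmx c Y.
Proof. by apply/matrixP => i j; rewrite !mxE scalerDr. Qed.

Lemma scmxDl m n (c d : C) (X : 'M[V]_(m, n)) :
  scmx (c + d) X = scmx c X + scmx d X.
Proof. by apply/matrixP => i j; rewrite !mxE scalerDl. Qed.

Lemma scmxA m n (c d : C) (X : 'M[V]_(m, n)) :
  scmx c (scmx d X) = scmx (c * d) X.
Proof. by apply/matrixP => i j; rewrite !mxE scalerA. Qed.

Lemma scmx0 m n (c : C) : scmx c (0 : 'M[V]_(m, n)) = 0.
Proof. by apply/matrixP => i j; rewrite !mxE scaler0. Qed.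

Lemma scmx0l m n (X : 'M[V]_(m, n)) : scmx (0 : C) X = 0.
Proof. by apply/matrixP => i j; rewrite !mxE scale0r. Qed.

Lemma scmxN m n (c : C) (X : 'M[V]_(m, n)) : scmx c (- X) = - scmx c X.
Proof. by apply/matrixP => i j; rewrite !mxE scalerN. Qed.

Lemma scmxNl m n (c : C) (X : 'M[V]_(m, n)) : scmx (- c) X = - scmx c X.
Proof. by apply/matrixP => i j; rewrite !mxE scaleNr. Qed.

Lemma scmx_sum m n (c : C) (I : Type) (r : seq I) (P : pred I)
    (F : I -> 'M[V]_(m, n)) :
  scmx c (\sum_(i <- r | P i) F i) = \sum_(i <- r | P i) scmx c (F i).
Proof. by apply: (big_morph _ (scmxD c) (scmx0 _ _ c)). Qed.

(** Prepending X turns the affine slice through X into the part with first coefficient 1 of a linear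
    span, and [fin_open_set] speaks of linear spans only. *)
Definition consfam n k (X : 'M[V]_n) (Zs : 'I_k -> 'M[V]_n) (i : 'I_(1 + k)) :=
  match fintype.split i with inl _ => X | inr j => Zs j end.

Lemma lincomb_cons n k (X : 'M[V]_n) (Zs : 'I_k -> 'M[V]_n)
    (a : 'rV[C^o]_1) (d : 'rV[C^o]_k) :
  lincomb (row_mx a d) (consfam X Zs) = scmx (a 0 0) X + lincomb d Zs.
Proof.
rewrite /lincomb big_split_ord /= big_ord1; congr (_ + _).
  by rewrite row_mxEl /consfam; case: fintype.splitP => // j /= /eqP; rewrite ?ord1.
apply: eq_bigr => i _; rewrite row_mxEr /consfam.
case: fintype.splitP => [j|j /addnI /val_inj -> //].
by rewrite /= ord1.
Qed.

Lemma lincombZ n k (s : C) (d : 'rV[C^o]_k) (Zs : 'I_k -> 'M[V]_n) :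
  lincomb (s *: d) Zs = scmx s (lincomb d Zs).
Proof.
by rewrite /lincomb scmx_sum; apply: eq_bigr => i _; rewrite mxE scmxA.
Qed.

Lemma lincombD n k (c d : 'rV[C^o]_k) (Zs : 'I_k -> 'M[V]_n) :
  lincomb (c + d) Zs = lincomb c Zs + lincomb d Zs.
Proof.
by rewrite /lincomb -big_split; apply: eq_bigr => i _; rewrite mxE scmxDl.
Qed.

Lemma fin_open_near n (U : set 'M[V]_n) (X : 'M[V]_n) k (Zs : 'I_k -> 'M[V]_n) :
  fin_open_set U -> U X -> exists2 d : R, 0 < d &
    forall c : 'rV[C^o]_k, (forall i, cabs (c 0 i) < d) -> U (X + lincomb c Zs).
Proof.
move=> oU UX; have /open_rVP /(_ (row_mx 1 0)) := oU _ (consfam X Zs).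
rewrite /= lincomb_cons !mxE eqxx /= scmx1.
have -> : lincomb 0 Zs = 0.
  by rewrite /lincomb big1 // => i _; rewrite mxE scmx0l.
rewrite addr0 => /(_ UX)[d d0 dU]; exists d => // c cd.
have := dU (row_mx 1 c); rewrite lincomb_cons mxE eqxx scmx1; apply => i.
rewrite !mxE; case: fintype.split => j; first by rewrite subrr cabs0.
by rewrite !mxE subr0.
Qed.

Lemma fin_open_line n (U : set 'M[V]_n) (X Z : 'M[V]_n) :
  fin_open_set U -> U X -> exists2 d : R, 0 < d &
    forall t : C, cabs t < d -> U (X + scmx t Z).
Proof.
move=> oU UX; have [d d0 dU] := @fin_open_near n U X 1 (fun=> Z) oU UX.
exists d => // t td; have := dU (const_mx t).
by rewrite /lincomb big_ord1 mxE; apply => i; rewrite mxE.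
Qed.

End Families.

(** * Admissible norms of submatrices, and bidiagonal matrices inside [Om] *)

Section AdmissibleNorms.
Context {R : realType} {V : lmodType R[i]} {W : normedModType R[i]}
  {nrm : forall n, 'M[W]_n -> R} {Om : forall n, set 'M[V]_n}
  {f : forall n, 'M[V]_n -> 'M[W]_n}.
Local Notation C := R[i].
Hypotheses (Om_nc : nc_set Om) (Om_open : fin_open Om) (nrm_adm : admissible nrm)
  (f_nc : nc_fun Om f) (f_bdd : loc_bdd_slices Om nrm f).

Lemma nrm_ge0 n (X : 'M[W]_n) : 0 <= nrm X.
Proof. by case: nrm_adm => /(_ n)[]. Qed.

Lemma nrm_eq0 n (X : 'M[W]_n) : nrm X = 0 -> X = 0.
Proof. by case: nrm_adm => /(_ n)[_ h] *; apply: h. Qed.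

Lemma nrmZ n c (X : 'M[W]_n) : nrm (scmx c X) = cabs c * nrm X.
Proof. by case: nrm_adm => /(_ n)[]. Qed.

Lemma nrmD n (X Y : 'M[W]_n) : nrm (X + Y) <= nrm X + nrm Y.
Proof. by case: nrm_adm => /(_ n)[]. Qed.

(* The submatrix is cut out as S X T (+) 0 with 0-1 matrices S and T. *)
Lemma nrm_mxsub n N (p q : 'I_n -> 'I_N) : (n <= N)%N ->
  exists2 c : R, 0 < c & forall X : 'M[W]_N, nrm (mxsub p q X) <= c * nrm X.
Proof.
move=> nN; move: p q; rewrite -(subnKC nN); set m := (N - n)%N => p q.
have [_ _ /(_ n m)[c1 c10 [c1' _ h1]] /(_ (n + m)%N)[c2 c20 h2]] := nrm_adm.
pose S : 'M[C]_(n + m) := col_mx (\matrix_(i, k) (k == p i)%:R) 0.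
pose T : 'M[C]_(n + m) := row_mx (\matrix_(k, j) (k == q j)%:R) 0.
exists (Num.max 1 (c1 * (c2 * opnorm S * opnorm T))).
  by rewrite lt_max ltr01.
move=> X; have e : lmx S (rmx X T) = dsum (mxsub p q X) (0 : 'M[W]_m).
  apply/matrixP => i j; rewrite mxE.
  under eq_bigr => k _ do rewrite [rmx X T k j]mxE scaler_sumr.
  rewrite /S /T /dsum; case: (split_ordP i) => {}i ->; last first.
    rewrite big1 => [|k _]; last first.
      by rewrite big1 // => l _; rewrite col_mxEd mxE scale0r.
    by case: (split_ordP j) => {}j ->; rewrite ?block_mxEdl ?block_mxEdr mxE.
  case: (split_ordP j) => {}j ->; last first.
    rewrite big1 => [|k _]; last first.
      by rewrite big1 // => l _; rewrite row_mxEr [in _ *: X _ _]mxE scale0r scaler0.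
    by rewrite block_mxEur mxE.
  rewrite block_mxEul mxE (bigD1 (p i)) //= [X in _ + X]big1 => [|k /negbTE kp].
    rewrite addr0 (bigD1 (q j)) //= big1 => [|l /negbTE lq].
      by rewrite addr0 col_mxEu row_mxEl !mxE !eqxx !scale1r.
    by rewrite row_mxEl [in _ *: X _ _]mxE lq scale0r scaler0.
  by rewrite big1 // => l _; rewrite col_mxEu mxE kp scale0r.
have /andP[+ _] := h1 (mxsub p q X) 0; rewrite -e => h.
have {}h : nrm (mxsub p q X) <= c1 * nrm (lmx S (rmx X T)).
  rewrite -ler_pdivrMl //; apply: le_trans h.
  by rewrite ler_pM2l ?invr_gt0 // le_max lexx.
apply: (le_trans h).
apply: (@le_trans _ _ (c1 * (c2 * opnorm S * opnorm T) * nrm X)).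
  rewrite -!mulrA ler_pM2l // (le_trans (h2 S T X)) // -!mulrA.
  by rewrite (mulrC (nrm X)).
by apply: ler_wpM2r; rewrite ?nrm_ge0 // le_max lexx orbT.
Qed.

Lemma Om_cast n m (e : n = m) (X : 'M[V]_n) : Om X -> Om (castmx (e, e) X).
Proof. by case: _ / e. Qed.

Lemma Om_diag n (Y : 'M[V]_n) l : Om Y -> Om (tri Y Y 0 l).
Proof.
move=> oY.
have -> : tri Y Y 0 l = @mxdiag V l.+1 (fun=> n) (fun=> Y).
  by apply: eq_blockmx => i j; rewrite conform_mx_id !if_same.
elim: l => [|l IH]; rewrite mxdiag_recl; last exact/Om_cast/Om_nc.
(* The recursion ends in an empty block whose size is a sum over no index. Once this size is
   identified with 0, the direct sum is a cast of Y. *)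
apply: Om_cast; set D := mxdiag _; move: D.
have : (\sum_(i < 0) n = 0)%N by rewrite big_ord0.
move: (\sum_(i < 0) n)%N => m /esym; case: _ / => D.
have -> : block_mx Y 0 0 D = castmx (esym (addn0 n), esym (addn0 n)) Y.
  apply/matrixP => i j; rewrite castmxE /=.
  case: (split_ordP i) => [{}i ->|[]//]; case: (split_ordP j) => [{}j ->|[]//].
  by rewrite block_mxEul; congr (Y _ _); exact: val_inj.
exact: Om_cast.
Qed.

(** The diagonal is a direct sum of copies of Y, hence in [Om], and openness along the superdiagonal
    direction gives e. Without the small factor c the matrix is only known to be similar to a point
    of [Om]. *)
Lemma Om_bidiag n (Y Z : 'M[V]_n) l : Om Y -> exists2 e : R, 0 < e &
  forall c : C, cabs c < e -> Om (bidiag Y (scmx c Z) l).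
Proof.
move=> oY; have [e e0 he] := fin_open_line (tri 0 0 Z l) (@Om_open _) (Om_diag l oY).
exists e => // c /he; congr Om; rewrite bidiagE; apply/matrixP => i j.
rewrite !mxE; case: ifP => _; first by rewrite !if_same mxE scaler0 addr0.
by case: ifP; rewrite !mxE ?add0r // scaler0.
Qed.

End AdmissibleNorms.

(** * Corner blocks of [f] and the expansion with remainder *)

Section TaylorTaylor.
Context {R : realType} {V : lmodType R[i]} {W : normedModType R[i]}
  {nrm : forall n, 'M[W]_n -> R} {Om : forall n, set 'M[V]_n}
  {f : forall n, 'M[V]_n -> 'M[W]_n}.
Local Notation C := R[i].
Hypotheses (Om_nc : nc_set Om) (Om_open : fin_open Om) (nrm_adm : admissible nrm)
  (f_nc : nc_fun Om f) (f_bdd : loc_bdd_slices Om nrm f).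

Lemma sum_delta (U : lmodType C) n p (F : 'I_p -> 'M[U]_n) (c : 'I_p -> C) (k : 'I_p) :
  (forall j, j != k -> c j = 0) -> \sum_j scmx (c j) (F j) = scmx (c k) (F k).
Proof.
move=> ck; rewrite (bigD1 k) //= big1 ?addr0 // => j /ck ->; exact: scmx0l.
Qed.

(* Intertwine with the inclusion of the first j+1 blocks. *)
Lemma f_tri_block n (Y Y' Z : 'M[V]_n) l j : (j < l)%N ->
  Om (tri Y Y' Z l) -> Om (tri Y Y Z j) ->
  blockof (f (tri Y Y' Z l)) ord0 (inord j) =
  blockof (f (tri Y Y Z j)) ord0 ord_max.
Proof.
move=> jl ol oj.
pose s (i : 'I_l.+1) (k : 'I_j.+1) : C := (i == k :> nat)%:R.
have wk (k : 'I_j.+1) : (k < l.+1)%N by rewrite (leq_trans (ltn_ord k)) // ltnW.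
have inT (U : lmodType C) (F : 'I_l.+1 -> 'M[U]_n) k :
    \sum_i scmx (s i k) (F i) = F (Ordinal (wk k)).
  rewrite (sum_delta F (k := Ordinal (wk k))) ?/s ?eqxx ?scmx1 // => i.
  by rewrite -val_eqE /= => /negbTE ->.
have e : rmx (tri Y Y' Z l) (tensmx n s) = lmx (tensmx n s) (tri Y Y Z j).
  apply: blockof_inj => i k; rewrite rmx_tens lmx_tens inT /tri blockmxK.
  have [ij|ij] := ltnP i j.+1.
    rewrite (sum_delta _ (k := Ordinal ij)) => [|k']; last first.
      by rewrite -val_eqE /= eq_sym /s => /negbTE ->.
    rewrite /s /= eqxx scmx1 blockmxK -!val_eqE /= if_same.
    (* As i <= j < l, row i is not the last one, so its diagonal block is Y and not Y'. *)
    case: eqP => [ik|//]; rewrite ifF //; apply/negbTE.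
    by rewrite neq_ltn (leq_ltn_trans _ jl) // -ltnS ij.
  rewrite big1 => [|k' _]; last first.
    rewrite /s; case: eqP => [ik|_]; last by rewrite scmx0l.
    by move: ij; rewrite ik ltnNge -ltnS ltn_ord.
  have ki : (k < i)%N by apply: leq_trans ij.
  rewrite ifF; last by apply/negbTE; rewrite -val_eqE /= neq_ltn ki orbT.
  by rewrite ifF //; apply/negbTE; rewrite /= neq_ltn (ltn_trans ki).
have := nc_intertwine Om_nc (proj1 f_nc) (proj2 f_nc) ol oj e.
move/(congr1 (fun F => blockof F ord0 ord_max)); rewrite rmx_tens lmx_tens inT.
rewrite (sum_delta _ (k := ord0)) => [|k]; last first.
  by rewrite -val_eqE /= eq_sym /s => /negbTE ->.
rewrite /s /= scmx1 => <-; congr blockof; apply: val_inj.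
by rewrite /= inordK // (ltn_trans jl).
Qed.

(* Intertwine with the column of blocks (t/e)^i I. *)
Lemma f_tri_col n (Y Z : 'M[V]_n) l (e t : C) : e != 0 ->
  Om (tri Y (Y + scmx t Z) (scmx e Z) l) -> Om (Y + scmx t Z) ->
  f (Y + scmx t Z) = \sum_(j < l.+1) scmx ((t / e) ^+ j)
     (blockof (f (tri Y (Y + scmx t Z) (scmx e Z) l)) ord0 j).
Proof.
move=> e0 oT oY; set T := tri _ _ _ _ in oT *; set X := Y + _ in T oT oY *.
pose v := tenscol n (fun i : 'I_l.+1 => (t / e) ^+ i).
have h : rmx T v = lmx v X.
  apply/matrixP => a b; rewrite -(@tagnat.sig2K l.+1 (fun=> n) a).
  rewrite rmx_tenscol lmx_tenscol; congr (fun_of_matrix _ _ _).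
  move: (tagnat.sig1 a) => {a b} i; rewrite /T /tri.
  have [->|im] := eqVneq i ord_max.
    rewrite (bigD1 ord_max) //= big1 => [|k km]; rewrite blockmxK.
      by rewrite eqxx addr0.
    rewrite eq_sym (negbTE km) ifF ?scmx0 //.
    by apply/negbTE; rewrite neq_ltn ltn_ord.
  have il : (i.+1 < l.+1)%N.
    by rewrite ltnS ltn_neqAle -ltnS ltn_ord andbT; move: im; rewrite -val_eqE.
  rewrite (bigD1 i) //= (bigD1 (Ordinal il)) /=; last first.
    by rewrite -val_eqE /= neq_ltn ltnSn orbT.
  rewrite big1 => [|k /andP[ki ki1]]; rewrite !blockmxK.
    rewrite eqxx (negbTE im) -val_eqE /= ifF; last first.
      by apply/negbTE; rewrite neq_ltn ltnSn.
    (* Row i of T v is (t/e)^i Y + (t/e)^(i+1) e Z = (t/e)^i (Y + tZ). The last row has no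
       superdiagonal block, which is why its diagonal block has to be Y + tZ. *)
    rewrite eqxx addr0 scmxD !scmxA exprSr -mulrA divfK //.
  rewrite eq_sym (negbTE ki) ifF ?scmx0 //.
  by apply/negbTE; move: ki1; rewrite -val_eqE.
have := nc_intertwine Om_nc (proj1 f_nc) (proj2 f_nc) oT oY h.
move/matrixP => E; apply/matrixP => a b.
have := E (@tagnat.Rank l.+1 (fun=> n) ord0 a) b.
by rewrite rmx_tenscol lmx_tenscol /= expr0 scmx1 => <-.
Qed.

(** Conjugation by diag(1, e, ..., e^l) (x) I trades the factor e on the superdiagonal for e^l in
    the corner block. Thus [DeltaR], defined through a choice in [ncext], is computed by [f] at a
    point of [Om]. *)
Lemma DeltaR_scale n (Y Z : 'M[V]_n) l (e : C) : e != 0 ->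
  Om (bidiag Y (scmx e Z) l) ->
  scmx (e ^+ l) (DeltaR Om f Y Z l) =
  blockof (f (bidiag Y (scmx e Z) l)) ord0 ord_max.
Proof.
move=> e0 oB; pose s c (i j : 'I_l.+1) : C := if i == j then c ^+ i else 0.
have uD : tensmx n (s e) \in unitmx.
  suff /mulmx1_unit[] : tensmx n (s e) *m tensmx n (s e^-1) = 1%:M by [].
  rewrite tens_mul -tens1; apply: eq_blockmx => i k; congr (_%:M).
  rewrite (bigD1 i) //= big1 => [|j]; rewrite /s ?eqxx ?addr0.
    case: eqP => _; rewrite ?mulr0 // -exprMn divff // expr1n //.
  by rewrite eq_sym => /negbTE ->; rewrite mul0r.
have sl (U : lmodType C) c (F : 'I_l.+1 -> 'M[U]_n) i :
    \sum_j scmx (s c i j) (F j) = scmx (c ^+ i) (F i).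
  rewrite (sum_delta _ (k := i)) /s ?eqxx // => k.
  by rewrite eq_sym => /negbTE ->.
have sr (U : lmodType C) c (F : 'I_l.+1 -> 'M[U]_n) i :
    \sum_j scmx (s c j i) (F j) = scmx (c ^+ i) (F i).
  by rewrite (sum_delta _ (k := i)) /s ?eqxx // => k /negbTE ->.
have eB : bidiag Y Z l = simil (tensmx n (s e)) (bidiag Y (scmx e Z) l).
  apply/esym/simil_eq => //; apply: blockof_inj => i k.
  rewrite lmx_tens rmx_tens sl sr !bidiagE /tri !blockmxK !if_same.
  case: eqP => [->//|_]; case: eqP => [->|_]; last by rewrite !scmx0.
  by rewrite scmxA -exprSr.
rewrite [DeltaR _ _ _ _ _]/(blockof _ _ _) eB.
rewrite (ncext_simil Om_nc (proj1 f_nc) (proj2 f_nc)) //.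
set F := f _; have := lmx_simil F uD.
move/(congr1 (fun M => blockof M ord0 ord_max)); rewrite lmx_tens rmx_tens sl sr.
by rewrite expr0 scmx1.
Qed.

Lemma Om_bidiag_le n (Y Z : 'M[V]_n) l : Om Y -> exists2 e : R, 0 < e &
  forall (c : C) j, (j <= l)%N -> cabs c < e -> Om (bidiag Y (scmx c Z) j).
Proof.
move=> oY; elim: l => [|l [e e0 IH]].
  have [e e0 h] := Om_bidiag Om_nc Om_open Z 0 oY.
  by exists e => // c j; rewrite leqn0 => /eqP -> /h.
have [d d0 h] := Om_bidiag Om_nc Om_open Z l.+1 oY.
exists (Num.min e d); rewrite ?lt_min ?e0 // => c j.
rewrite leq_eqVlt ltnS => /predU1P[->|jl]; rewrite lt_min => /andP[ce cd]; first exact: h.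
exact: IH.
Qed.

Lemma taylor_taylor n (Y Z : 'M[V]_n) N : Om Y ->
  exists2 d : R, 0 < d & exists K : R, forall t : C, cabs t < d ->
    Om (Y + scmx t Z) /\
    nrm (f (Y + scmx t Z) - \sum_(l < N) scmx (t ^+ l) (DeltaR Om f Y Z l))
      <= K * cabs t ^+ N.
Proof.
move=> oY; have [e e0 oB] := Om_bidiag_le Z N oY.
pose c : C := ((e / 2)%:C)%C.
have c0 : c != 0.
  by rewrite -cabs_gt0 cabs_real gtr0_norm divr_gt0.
have ce : cabs c < e by rewrite cabs_real gtr0_norm ?divr_gt0 //; lra.
have {}oB j : (j <= N)%N -> Om (bidiag Y (scmx c Z) j) by move=> /oB; apply.
have [d1 d10 h1] := fin_open_line Z (@Om_open _) oY.
have [d2 d20 h2] := fin_open_line (tri 0 Z 0 N) (@Om_open _) (oB N (leqnn N)).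
have [d3 d30 [M h3]] := f_bdd (tri 0 Z 0 N) (oB N (leqnn N)).
have triE t : bidiag Y (scmx c Z) N + scmx t (tri 0 Z 0 N) =
    tri Y (Y + scmx t Z) (scmx c Z) N.
  rewrite bidiagE; apply/matrixP => i j; rewrite !mxE; case: ifP => _.
    by rewrite if_same; case: ifP; rewrite !mxE ?scaler0 ?addr0.
  by rewrite if_same !mxE scaler0 addr0.
have nN : (n <= \sum_(i < N.+1) n)%N by rewrite big_ord_recl leq_addr.
have [b b0 hb] := nrm_mxsub nrm_adm (@tagnat.Rank N.+1 (fun=> n) ord0)
  (@tagnat.Rank N.+1 (fun=> n) ord_max) nN.
exists (Num.min d1 (Num.min d2 d3)); first by rewrite !lt_min d10 d20.
exists (b * M * (cabs c ^+ N)^-1) => t; rewrite !lt_min => /and3P[t1 t2 t3].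
have oX := h1 _ t1; split=> //.
have := h2 _ t2; have := h3 _ t3; rewrite triE => /[swap] oT /(_ oT) fM.
(* The term j = N is the remainder: its block is bounded by b M along the slice, and (t/c)^N
   supplies the power of t and the constant |c|^-N. The blocks with j < N do not see the moving
   corner and give the coefficients. *)
rewrite (f_tri_col (l := N) c0 oT oX) big_ord_recr /=.
rewrite (eq_bigr (fun l : 'I_N => scmx (t ^+ l) (DeltaR Om f Y Z l))).
  rewrite addrAC subrr add0r (nrmZ nrm_adm) cabsX cabsM cabsV exprMn exprVn.
  rewrite [X in _ <= X](_ : _ = cabs t ^+ N * (cabs c ^+ N)^-1 * (b * M)); last first.
    by rewrite mulrC [_ * M * _]mulrC mulrA.
  rewrite ler_wpM2l ?mulr_ge0 ?invr_ge0 ?exprn_ge0 ?cabs_ge0 //.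
  by rewrite (le_trans (hb _)) // ler_pM2l.
move=> i _.
have -> : widen_ord (leqnSn N) i = inord i.
  by apply: val_inj; rewrite /= inordK // ltnW // ltnS.
have iN : (i <= N)%N by apply: ltnW.
rewrite f_tri_block ?ltn_ord // -?bidiagE; try exact: oB.
rewrite -DeltaR_scale //; last exact: oB.
by rewrite scmxA -exprMn divfK.
Qed.

End TaylorTaylor.

(** * Maximum modulus principle for Peano expansions *)

Section Tubes.
Context {R : realType}.
Local Notation C := R[i].

Lemma right0P (P : R -> Prop) :
  (\forall s \near (0 : R)^'+, P s) <->
  exists2 s0, 0 < s0 & forall s, 0 < s < s0 -> P s.
Proof.
split=> [|[s0 s00 h]].
  rewrite /at_right => /nbhs_ballP[e e0 eP]; exists e => // s /andP[s1 s2].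
  by apply: eP => //; rewrite /ball /= sub0r normrN gtr0_norm.
apply/nbhs_ballP; exists s0 => // s.
rewrite /ball /= sub0r normrN => sb s1; apply: h.
by rewrite s1 -(gtr0_norm s1).
Qed.

(** Takes the place of finite subcovers: thresholds s0 that are locally uniform merge into one for
    all of K. The compactness arguments below pass through this form. *)
Lemma compact_tube (T : topologicalType) (K : set T) (P : R -> T -> Prop) :
  compact K ->
  (forall x, K x -> exists2 A, nbhs x A & exists2 s0, 0 < s0 &
     forall x' s, A x' -> 0 < s < s0 -> P s x') ->
  exists2 s0, 0 < s0 & forall s x, 0 < s < s0 -> K x -> P s x.
Proof.
move=> /compact_near_coveringP cK h.
have /right0P[s0 s00 hs] : \forall s \near (0 : R)^'+, K `<=` P s.
  apply: cK => x /h[A Ax [s0 s00 hA]].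
  exists (A, [set s | 0 < s < s0]) => /=; last by move=> [x' s] /= [] /hA h1 /h1.
  by split=> //; apply/right0P; exists s0.
by exists s0 => // s x /hs; apply.
Qed.

(** A closed subset of the continuous image of the square [-r, r]^2. *)
Lemma compact_disc (r : R) : compact [set z : C^o | cabs z <= r].
Proof.
pose phi (p : R * R) : C^o := (p.1 +i* p.2)%C.
have cphi : continuous phi.
  move=> p A /nbhs_CP[d d0 dA].
  exists (ball p.1 (d / 2), ball p.2 (d / 2)).
    by split; apply: nbhsx_ballx; rewrite divr_gt0.
  move=> [x y] [/=]; rewrite /ball /= => hx hy; apply: dA.
  have -> : phi (x, y) - phi p =
      (x - p.1)%:C%C + 'i%C * (y - p.2)%:C%C.
    by rewrite [LHS]complexE /= /phi.
  apply: le_lt_trans (cabsD _ _) _; rewrite cabsM !cabs_real.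
  have -> : cabs ('i%C : C) = 1 by rewrite /cabs /= expr0n /= add0r expr1n sqrtr1.
  by rewrite mul1r (splitr d) distrC [`|y - _|]distrC ltrD.
apply: (@subclosed_compact _ _ (phi @` (`[-r, r] `*` `[-r, r])%classic)).
- rewrite -openC openE => z /= /negP; rewrite -ltNge => rz.
  apply/nbhs_CP; exists (cabs z - r); rewrite ?subr_gt0 // => w wz /=.
  apply/negP; rewrite -ltNge.
  have h : cabs z <= cabs (w - z) + cabs w.
    by rewrite -cabs_distC -[X in cabs X <= _](subrK w) cabsD.
  by rewrite -(ltrD2l (cabs (w - z))) (lt_le_trans _ h) // -ltrBrDr.
- apply: continuous_compact; first exact: continuous_subspaceT.
  by apply: compact_setX; exact: segment_compact.
- move=> [x y] zr; change (is_true (cabs (x +i* y)%C <= r)) in zr.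
  exists (x, y) => //=.
  have h : x ^+ 2 <= r ^+ 2 /\ y ^+ 2 <= r ^+ 2.
    have : cabs (x +i* y)%C ^+ 2 = x ^+ 2 + y ^+ 2 by rewrite cabs_sqr.
    have : cabs (x +i* y)%C ^+ 2 <= r ^+ 2.
      by rewrite lerXn2r ?nnegrE ?cabs_ge0 // (le_trans _ zr) ?cabs_ge0.
    by have := sqr_ge0 x; have := sqr_ge0 y; split; lra.
  have r0 : 0 <= r by rewrite (le_trans _ zr) ?cabs_ge0.
  have sq v : v ^+ 2 <= r ^+ 2 -> `[-r, r]%classic v.
    move=> vr; rewrite /= in_itv /= -ler_norml.
    by rewrite -(@ler_pXn2r _ 2) ?nnegrE // real_normK ?num_real.
  by split=> /=; apply: sq; case: h.
Qed.

Lemma disc_tube (r : R) (P : R -> C -> Prop) :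
  (forall z, cabs z <= r -> exists2 d : R, 0 < d &
     forall w s, cabs (w - z) < d -> 0 < s < d -> P s w) ->
  exists2 s0, 0 < s0 & forall s z, 0 < s < s0 -> cabs z <= r -> P s z.
Proof.
move=> h; apply: (compact_tube (@compact_disc r)) => z /h[d d0 dP].
exists [set w | cabs (w - z) < d]; first by apply/nbhs_CP; exists d.
by exists d => // w s; exact: dP.
Qed.

(** Upper semicontinuity suffices. [disc_tube] is applied to the bounds s^-1 and sup A - s: the
    former makes u bounded above, the latter shows that an unattained supremum could be lowered. *)
Lemma disc_max (r : R) (u : C -> R) : 0 <= r ->
  (forall z, cabs z <= r -> forall e : R, 0 < e -> exists2 d : R, 0 < d &
     forall w, cabs (w - z) < d -> u w < u z + e) ->
  exists2 z0, cabs z0 <= r & forall z, cabs z <= r -> u z <= u z0.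
Proof.
move=> r0 hu; apply: contrapT => nmax.
pose A := [set u z | z in [set z | cabs z <= r]].
have A0 : A !=set0 by exists (u 0), 0 => //=; rewrite cabs0.
have [s0 s00 hs] : exists2 s0, 0 < s0 & forall s z, 0 < s < s0 -> cabs z <= r ->
    u z < s^-1.
  apply: (@disc_tube r (fun s z => u z < s^-1)) => z zr.
  have [d d0 hd] := hu z zr 1 ltr01.
  pose B := `|u z| + 1; have B0 : 0 < B by rewrite ltr_wpDl.
  exists (Num.min d B^-1); first by rewrite lt_min d0 invr_gt0.
  move=> w s; rewrite !lt_min => /andP[wd _] /and3P[sp sd sB].
  apply: (lt_le_trans (hd _ wd)); apply: (@le_trans _ _ B).
    by rewrite lerD2r ler_norm.
  by rewrite -[B]invrK lef_pV2 ?posrE ?invr_gt0 // ltW.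
have supA : has_sup A.
  split=> //; exists (s0 / 2)^-1 => _ [z zr <-]; apply/ltW/hs => //.
  by rewrite divr_gt0 //=; lra.
have ltS z : cabs z <= r -> u z < sup A.
  move=> zr; rewrite lt_neqAle sup_upper_bound ?andbT //; last by exists z.
  apply/eqP => e; apply: nmax; exists z => // w wr.
  by rewrite e sup_upper_bound //; exists w.
have [s1 s10 h1] : exists2 s0, 0 < s0 & forall s z, 0 < s < s0 -> cabs z <= r ->
    u z <= sup A - s.
  apply: (@disc_tube r (fun s z => u z <= sup A - s)) => z zr.
  have e0 : 0 < (sup A - u z) / 2 by rewrite divr_gt0 // subr_gt0 ltS.
  have [d d0 hd] := hu z zr _ e0.
  exists (Num.min d ((sup A - u z) / 2)); first by rewrite lt_min d0.
  move=> w s; rewrite !lt_min => /andP[wd _] /and3P[sp sd sB].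
  have := hd _ wd; lra.
have : sup A <= sup A - s1 / 2.
  apply: ge_sup => // _ [z zr <-]; apply: h1 => //.
  by rewrite divr_gt0 //=; lra.
lra.
Qed.

End Tubes.

Definition poly3 {R : realType} {E : lmodType R[i]} (h : R[i]) (a0 a1 a2 : E) : E :=
  a0 + h *: a1 + h ^+ 2 *: a2.

Section Maximum.
Context {R : realType} {E : lmodType R[i]} (N : E -> R).
Local Notation C := R[i].
Hypotheses (N_ge0 : forall x, 0 <= N x) (N_eq0 : forall x, N x = 0 -> x = 0)
  (NZ : forall (c : C) x, N (c *: x) = cabs c * N x)
  (ND : forall x y, N (x + y) <= N x + N y).

(* Third-order Peano expansion of g at z, the only regularity the maximum
   principle needs. *)
Definition pexp3 (g : C -> E) (z : C) := exists a0 a1 a2 : E,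
  exists2 d : R, 0 < d & exists2 K : R, 0 <= K & forall h, cabs h < d ->
    N (g (z + h) - poly3 h a0 a1 a2) <= K * cabs h ^+ 3.

Lemma N0 : N 0 = 0.
Proof. by rewrite -(scale0r 0) NZ cabs0 mul0r. Qed.

Lemma NN x : N (- x) = N x.
Proof. by rewrite -scaleN1r NZ cabsN cabs1 mul1r. Qed.

Lemma NB x y : N (x - y) <= N x + N y.
Proof. by rewrite -(NN y) ND. Qed.

Lemma N_distC x y : N (x - y) = N (y - x).
Proof. by rewrite -NN opprB. Qed.

Lemma N_sum (I : Type) (r : seq I) (P : pred I) (F : I -> E) :
  N (\sum_(i <- r | P i) F i) <= \sum_(i <- r | P i) N (F i).
Proof.
elim/big_ind2 : _ => //; first by rewrite N0.
by move=> x1 x2 y1 y2 h1 h2; apply: le_trans (ND _ _) (lerD h1 h2).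
Qed.

Lemma pexp3P (g : C -> E) z : pexp3 g z -> exists a1 a2 : E,
  exists2 d : R, 0 < d <= 1 & exists2 K : R, 0 <= K & forall h, cabs h < d ->
    N (g (z + h) - poly3 h (g z) a1 a2) <= K * cabs h ^+ 3.
Proof.
move=> [a0 [a1 [a2 [d d0 [K K0 h]]]]]; exists a1, a2.
have e : g z = a0.
  have := h 0; rewrite cabs0 addr0 => /(_ d0).
  rewrite /poly3 !expr0n /= !scale0r !addr0 mulr0 => le0.
  by apply/eqP; rewrite -subr_eq0; apply/eqP/N_eq0/eqP; rewrite eq_le le0 N_ge0.
exists (Num.min d 1).
  by rewrite lt_min d0 ltr01 ge_min lexx orbT.
by exists K => // w; rewrite lt_min => /andP[/h + _]; rewrite e.
Qed.

Lemma N_poly3 h a0 a1 a2 : cabs h <= 1 ->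
  N (poly3 h a0 a1 a2 - a0) <= cabs h * (N a1 + N a2).
Proof.
move=> h1; rewrite /poly3 -[_ + _ *: a2]addrA [a0 + _]addrC addrK.
apply: le_trans (ND _ _) _; rewrite !NZ cabsX mulrDr lerD2l.
by rewrite ler_wpM2r // expr2 ler_piMl // cabs_ge0.
Qed.

Lemma pexp3_lip (g : C -> E) z : pexp3 g z ->
  exists2 d : R, 0 < d <= 1 & exists2 L : R, 0 <= L & forall h, cabs h < d ->
    N (g (z + h) - g z) <= L * cabs h.
Proof.
move=> /pexp3P[a1 [a2 [d /andP[d0 d1] [K K0 hK]]]]; exists d; rewrite ?d0 //.
exists (K + (N a1 + N a2)) => [|h hd]; first by rewrite !addr_ge0.
have h1 : cabs h <= 1 by rewrite (le_trans (ltW hd)).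
have -> : g (z + h) - g z =
    (g (z + h) - poly3 h (g z) a1 a2) + (poly3 h (g z) a1 a2 - g z).
  by rewrite addrA subrK.
apply: le_trans (ND _ _) _; rewrite mulrDl lerD //; last first.
  by rewrite mulrC N_poly3.
apply: le_trans (hK _ hd) _; rewrite ler_wpM2l //.
by rewrite exprS ler_piMr ?cabs_ge0 // exprn_ile1 // cabs_ge0.
Qed.

Lemma poly3_pair (h : C) (a0 a1 a2 : E) :
  poly3 h a0 a1 a2 + poly3 (- h) a0 a1 a2 = 2 *: a0 + (2 * h ^+ 2) *: a2.
Proof.
rewrite /poly3 addrACA sqrrN -scalerDl [X in X + _]addrACA -scalerDl subrr.
by rewrite scale0r addr0 scaler_nat mulr_natl !mulr2n.
Qed.

Lemma poly3_four (h : C) (a0 a1 a2 : E) :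
  poly3 h a0 a1 a2 + poly3 (- h) a0 a1 a2 +
  (poly3 ('i%C * h) a0 a1 a2 + poly3 (- ('i%C * h)) a0 a1 a2) = 4 *: a0.
Proof.
rewrite !poly3_pair addrACA -!scalerDl exprMn sqr_i mulN1r mulrN subrr scale0r.
by rewrite addr0 -natrD.
Qed.

Lemma cabs_i : cabs ('i%C : C) = 1.
Proof. by rewrite /cabs /= expr0n /= add0r expr1n sqrtr1. Qed.

Lemma cabs_sqr_four (z : C) (h : R) :
  cabs (z + h%:C%C) ^+ 2 + cabs (z + - h%:C%C) ^+ 2 +
  (cabs (z + 'i%C * h%:C%C) ^+ 2 + cabs (z + - ('i%C * h%:C%C)) ^+ 2) =
  4 * cabs z ^+ 2 + 4 * h ^+ 2.
Proof.
case: z => a b; rewrite !cabs_sqr /= !(mul0r, mulr0, mul1r, subr0, add0r, addr0).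
rewrite !(oppr0, addr0); ring.
Qed.

(* If N g + e |z|^2 is maximal at an interior point z0, averaging over
   z0 +- h, z0 +- i h kills the Taylor terms of degree 1 and 2 of g, while
   e |z|^2 contributes e h^2, which beats the cubic error. *)
Lemma max_modulus (g : C -> E) (r M : R) : 0 < r ->
  (forall z, cabs z <= r -> pexp3 g z) ->
  (forall z, cabs z = r -> N (g z) <= M) ->
  forall z, cabs z <= r -> N (g z) <= M.
Proof.
move=> r0 gr gM z1 z1r; rewrite leNgt; apply/negP => Mz1.
(* On the circle the term e |z|^2 equals half the excess of N (g z1) over M, so u stays below u z1
   there and its maximum is interior. *)
pose e := (N (g z1) - M) / 2 / r ^+ 2.
have r20 : 0 < r ^+ 2 by rewrite exprn_gt0.
have e0 : 0 < e by rewrite !divr_gt0 // subr_gt0.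
have er : e * r ^+ 2 = (N (g z1) - M) / 2 by rewrite divfK // gt_eqF.
pose u z := N (g z) + e * cabs z ^+ 2.
have [z0 z0r umax] : exists2 z0, cabs z0 <= r &
    forall z, cabs z <= r -> u z <= u z0.
  apply: disc_max (ltW r0) _ => z zr t t0.
  have [d /andP[d0 d1] [L L0 hL]] := pexp3_lip (gr z zr).
  pose B := L + e * (2 * cabs z + 1) + 1.
  have B0 : 0 < B.
    rewrite /B ltr_wpDl // addr_ge0 // mulr_ge0 ?(ltW e0) // addr_ge0 //.
    by rewrite mulr_ge0 // cabs_ge0.
  exists (Num.min d (t / B)); first by rewrite lt_min d0 divr_gt0.
  move=> w; rewrite lt_min => /andP[wd wt].
  have := hL _ wd; rewrite [z + _]addrC subrK => hw.
  have h1 : N (g w) <= N (g z) + L * cabs (w - z).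
    have -> : g w = g z + (g w - g z) by rewrite addrC subrK.
    by rewrite (le_trans (ND _ _)) // lerD2l.
  set x := cabs (w - z) in wd wt hw h1.
  have x0 : 0 <= x by exact: cabs_ge0.
  have h2 : cabs w <= cabs z + x.
    have -> : w = z + (w - z) by rewrite addrC subrK.
    exact: cabsD.
  have h3 : cabs w ^+ 2 <= (cabs z + x) ^+ 2.
    by rewrite lerXn2r ?nnegrE ?cabs_ge0 // addr_ge0 // cabs_ge0.
  have h4 : e * cabs w ^+ 2 <= e * (cabs z ^+ 2 + (2 * cabs z + 1) * x).
    rewrite ler_pM2l //; apply: (le_trans h3); have x1 : x <= 1 by lra.
    by have := cabs_ge0 z; nra.
  have h5 : B * x < t by rewrite mulrC -ltr_pdivlMr.
  rewrite /u; move: h5; rewrite /B; lra.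
have z0lt : cabs z0 < r.
  rewrite lt_neqAle z0r andbT; apply/eqP => z0e.
  have := umax _ z1r; rewrite /u z0e er.
  have : 0 <= e * cabs z1 ^+ 2 by rewrite mulr_ge0 ?exprn_ge0 ?cabs_ge0 // ltW.
  have := gM _ z0e; lra.
have [a1 [a2 [d /andP[d0 d1] [K K0 hK]]]] := pexp3P (gr z0 z0r).
(* The three bounds keep h in the range of the expansion at z0, keep the four points in the disc,
   and make K h < e, so that e h^2 beats K h^3. *)
pose h := Num.min (d / 2) (Num.min (r - cabs z0) (e / (2 * (K + 1)))).
have K1 : 0 < K + 1 by rewrite ltr_wpDl.
have h0 : 0 < h.
  by rewrite !lt_min divr_gt0 //= subr_gt0 z0lt divr_gt0 // mulr_gt0.
have hd : h < d.
  by apply: (@le_lt_trans _ _ (d / 2)); [rewrite ge_min lexx | lra].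
have hr : cabs z0 + h <= r.
  have : h <= r - cabs z0 by rewrite !ge_min lexx orbT.
  lra.
have hK' : K * h < e.
  have : h <= e / (2 * (K + 1)) by rewrite !ge_min lexx !orbT.
  by rewrite ler_pdivlMr ?mulr_gt0 //; nra.
have hc : cabs h%:C%C = h by rewrite cabs_real gtr0_norm.
have nw w : cabs w = h -> N (g (z0 + w)) + e * cabs (z0 + w) ^+ 2 <= u z0 /\
    N (poly3 w (g z0) a1 a2) <= N (g (z0 + w)) + K * h ^+ 3.
  move=> wh; split.
    by apply: umax; rewrite (le_trans (cabsD _ _)) // wh.
  have := hK w; rewrite wh => /(_ hd) => {}hw.
  set p := poly3 _ _ _ _ in hw *; set q := g (z0 + w) in hw *.
  have -> : p = q + (p - q) by rewrite addrC subrK.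
  by rewrite (le_trans (ND _ _)) // lerD2l N_distC.
have [u1 p1] := nw _ hc.
have [u2 p2] := nw (- h%:C%C) (etrans (cabsN _) hc).
have hi : cabs ('i%C * h%:C%C) = h by rewrite cabsM cabs_i mul1r.
have [u3 p3] := nw _ hi.
have [u4 p4] := nw (- ('i%C * h%:C%C)) (etrans (cabsN _) hi).
have := cabs_sqr_four z0 h.
have : 4 * N (g z0) <= N (poly3 h%:C%C (g z0) a1 a2) +
    N (poly3 (- h%:C%C) (g z0) a1 a2) + (N (poly3 ('i%C * h%:C%C) (g z0) a1 a2) +
    N (poly3 (- ('i%C * h%:C%C)) (g z0) a1 a2)).
  rewrite -{1}(cabs_nat 4) -NZ -(poly3_four (h%:C%C) (g z0) a1 a2).
  by apply: le_trans (ND _ _) (lerD _ _); exact: ND.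
move: u1 u2 u3 u4 p1 p2 p3 p4; rewrite /u.
set q1 := cabs (z0 + h%:C%C) ^+ 2; set q2 := cabs (z0 + - h%:C%C) ^+ 2.
set q3 := cabs (z0 + 'i%C * h%:C%C) ^+ 2.
set q4 := cabs (z0 + - ('i%C * h%:C%C)) ^+ 2.
move=> u1 u2 u3 u4 p1 p2 p3 p4 hN hq.
have : e * (q1 + q2 + (q3 + q4)) = e * (4 * cabs z0 ^+ 2 + 4 * h ^+ 2) by rewrite hq.
have : 0 < (e - K * h) * h ^+ 2 by rewrite mulr_gt0 ?exprn_gt0 // subr_gt0.
have -> : (e - K * h) * h ^+ 2 = e * h ^+ 2 - K * h ^+ 3 by ring.
lra.
Qed.

End Maximum.

(** * Cauchy estimates *)

Section RootsOfUnity.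
Context {R : realType}.
Local Notation C := R[i].

(** X^(n+1) - 1 splits over [C] and is separable in characteristic 0; its n+1 distinct roots include
    a primitive one. *)
Lemma prim_root_exists n : exists w : C, n.+1.-primitive_root w.
Proof.
pose p : {poly C} := 'X^(n.+1) - 1; have [r Dp] := closed_field_poly_normal p.
rewrite (monicP _) ?monicXnsubC // scale1r in Dp.
have rn1 : all n.+1.-unity_root r.
  by apply/allP=> z; rewrite -root_prod_XsubC -Dp.
have sz_r : (n.+1 < (size r).+1)%N.
  by rewrite -(size_prod_XsubC r id) -Dp size_XnsubC.
have [|z] := hasP (has_prim_root (ltn0Sn n) rn1 _ sz_r); last by exists z.
by rewrite -separable_prod_XsubC -Dp separable_Xn_sub_1 // pnatr_eq0.
Qed.

Lemma cabs_prim_root n (w : C) : n.+1.-primitive_root w -> cabs w = 1.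
Proof.
move=> /prim_expr_order/(congr1 cabs); rewrite cabsX cabs1 => /eqP.
by rewrite pexpr_eq1 ?cabs_ge0 // => /eqP.
Qed.

Lemma prim_root_orth n (w : C) i j : n.+1.-primitive_root w ->
  (i < n.+1)%N -> (j < n.+1)%N ->
  (n.+1%:R)^-1 * \sum_(k < n.+1) (w^-1) ^+ (j * k) * w ^+ (i * k) =
  (i == j)%:R.
Proof.
move=> pw ilt jlt.
have w0 : w != 0 by rewrite -cabs_gt0 (cabs_prim_root pw).
pose x := w ^+ i / w ^+ j.
have -> : \sum_(k < n.+1) w^-1 ^+ (j * k) * w ^+ (i * k) = \sum_(k < n.+1) x ^+ k.
  by apply: eq_bigr => k _; rewrite !exprM -exprMn mulrC exprVn.
have n0 : (n.+1%:R : C) != 0 by rewrite pnatr_eq0.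
have [ij|ij] := eqVneq i j.
  rewrite (eq_bigr (fun=> 1)) => [|k _]; last first.
    by rewrite /x ij divff ?expf_neq0 // expr1n.
  by rewrite sumr_const card_ord mulVf.
have x1 : x - 1 != 0.
  rewrite subr_eq0; apply/eqP => /(congr1 (fun y => y * w ^+ j)).
  rewrite /x divfK ?expf_neq0 // mul1r => /eqP.
  by rewrite (eq_prim_root_expr pw) !modn_small // (negbTE ij).
have := subrX1 x n.+1.
rewrite exprMn exprVn -!exprM ![(_ * n.+1)%N]mulnC !exprM.
rewrite (prim_expr_order pw) !expr1n invr1 mulr1 subrr => /esym/eqP.
by rewrite mulf_eq0 (negbTE x1) /= => /eqP ->; rewrite mulr0.
Qed.

End RootsOfUnity.

(** * Calculus of Peano expansions *)

Section Expansions.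
Context {R : realType}.
Local Notation C := R[i].

Lemma poly3_mul (E : lmodType C) (h p0 p1 p2 : C) (a0 a1 a2 : E) :
  (p0 + h * p1 + h ^+ 2 * p2) *: poly3 h a0 a1 a2 =
  poly3 h (p0 *: a0) (p1 *: a0 + p0 *: a1) (p2 *: a0 + p1 *: a1 + p0 *: a2) +
  h ^+ 3 *: (p2 *: a1 + p1 *: a2 + (h * p2) *: a2).
Proof.
have -> : poly3 h (p0 *: a0) (p1 *: a0 + p0 *: a1)
      (p2 *: a0 + p1 *: a1 + p0 *: a2) +
    h ^+ 3 *: (p2 *: a1 + p1 *: a2 + (h * p2) *: a2) =
    (p0 + h * p1 + h ^+ 2 * p2) *: a0 +
    (h * p0 + h ^+ 2 * p1 + h ^+ 3 * p2) *: a1 +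
    (h ^+ 2 * p0 + h ^+ 3 * p1 + h ^+ 3 * (h * p2)) *: a2.
  rewrite /poly3 !scalerDr !scalerDl !scalerA !addrA.
  by rewrite [LHS](ACl (1*2*4*3*5*7*6*8*9)).
rewrite /poly3 !scalerDr !scalerA; congr (_ + _ *: _ + _ *: _); ring.
Qed.

(** Splits the error of a product into the errors of its two factors and the truncation error t of
    the product of their expansions. *)
Lemma product_remainder (E : lmodType C) (a p : C) (b q r t : E) :
  p *: q = r + t -> a *: b - r = (a - p) *: b + p *: (b - q) + t.
Proof.
move=> e; rewrite scalerBl scalerBr [_ - _ + (_ - _)]addrA subrK e opprD addrA.
by rewrite subrK.
Qed.

Definition sexp3 (phi : C -> C) (z : C) := exists p0 p1 p2 : C,
  exists2 d : R, 0 < d <= 1 & exists2 K : R, 0 <= K & forall h, cabs h < d ->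
    cabs (phi (z + h) - (p0 + h * p1 + h ^+ 2 * p2)) <= K * cabs h ^+ 3.

Lemma sexp3_const (c z : C) : sexp3 (fun=> c) z.
Proof.
exists c, 0, 0, 1; rewrite ?ltr01 ?lexx //; exists 0 => // h _.
by rewrite !mulr0 !addr0 subrr cabs0 mul0r.
Qed.

Lemma sexp3_id (z : C) : sexp3 id z.
Proof.
exists z, 1, 0, 1; rewrite ?ltr01 ?lexx //; exists 0 => // h _.
by rewrite mulr1 !mulr0 !addr0 subrr cabs0 mul0r.
Qed.

(** The remainder is exactly -h^3 / (z^3 (z + h)), and |z + h| >= |z| / 2 on the chosen disc. *)
Lemma sexp3_inv (z : C) : z != 0 -> sexp3 (fun w => w^-1) z.
Proof.
move=> z0; have cz : 0 < cabs z by rewrite cabs_gt0.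
exists (z^-1), (- (z ^+ 2)^-1), ((z ^+ 3)^-1).
exists (Num.min 1 (cabs z / 2)); first by rewrite lt_min ltr01 divr_gt0 //= ge_min lexx.
exists (2 / cabs z ^+ 4) => [|h]; first by rewrite divr_ge0 // exprn_ge0 // ltW.
rewrite lt_min => /andP[_ hz].
have zh : cabs z / 2 <= cabs (z + h).
  have := cabsD (z + h) (- h); rewrite addrK cabsN; lra.
have zh0 : z + h != 0 by rewrite -cabs_gt0; lra.
have -> : (z + h)^-1 - (z^-1 + h * - (z ^+ 2)^-1 + h ^+ 2 * (z ^+ 3)^-1) =
    - (h ^+ 3 * (z ^+ 3)^-1 * (z + h)^-1) by field; rewrite z0 zh0.
rewrite cabsN (cabsM (_ * _)) (cabsM (h ^+ 3)) !cabsV !cabsX.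
rewrite [X in _ <= X]mulrC -mulrA.
rewrite ler_wpM2l ?exprn_ge0 ?cabs_ge0 //.
have -> : 2 / cabs z ^+ 4 = (cabs z ^+ 3)^-1 * (cabs z / 2)^-1.
  by field; rewrite gt_eqF.
by rewrite ler_wpM2l ?invr_ge0 ?exprn_ge0 ?cabs_ge0 // lef_pV2 ?posrE //; lra.
Qed.

Section InSpace.
Context {E : lmodType C} (N : E -> R).
Hypotheses (N_ge0 : forall x, 0 <= N x) (N_eq0 : forall x, N x = 0 -> x = 0)
  (NZ : forall (c : C) x, N (c *: x) = cabs c * N x)
  (ND : forall x y, N (x + y) <= N x + N y).

Lemma pexp3_scale (phi : C -> C) (g : C -> E) z :
  sexp3 phi z -> pexp3 N g z -> pexp3 N (fun w => phi w *: g w) z.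
Proof.
move=> [p0 [p1 [p2 [d /andP[d0 d1] [K K0 hK]]]]] gz.
have [d' /andP[d'0 _] [L' L'0 hL]] := pexp3_lip N_ge0 N_eq0 NZ ND gz.
have [a1 [a2 [d'' /andP[d''0 _] [K'' K''0 hK'']]]] := pexp3P N_ge0 N_eq0 gz.
set a0 := g z in hL hK''.
exists (p0 *: a0), (p1 *: a0 + p0 *: a1), (p2 *: a0 + p1 *: a1 + p0 *: a2).
exists (Num.min d (Num.min d' d'')); first by rewrite !lt_min d0 d'0.
exists (K * (N a0 + L') + (cabs p0 + cabs p1 + cabs p2) * K''
  + (N (p2 *: a1) + N (p1 *: a2) + cabs p2 * N a2)).
  by rewrite !addr_ge0 ?mulr_ge0 ?addr_ge0 ?cabs_ge0.
move=> h; rewrite !lt_min => /and3P[hd hd' hd''].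
have h1 : cabs h <= 1 by lra.
have h0 := cabs_ge0 h.
have h21 : cabs h ^+ 2 <= 1 by rewrite exprn_ile1.
move: (hK _ hd) (hL _ hd') (hK'' _ hd'') => {}hK {}hL {}hK''.
set p := (p0 + h * p1 + h ^+ 2 * p2) in hK.
set P := poly3 h a0 a1 a2 in hK''.
set A := phi (z + h) in hK *; set B := g (z + h) in hL hK'' *.
have -> : A *: B - poly3 h (p0 *: a0) (p1 *: a0 + p0 *: a1)
     (p2 *: a0 + p1 *: a1 + p0 *: a2) =
   ((A - p) *: B + p *: (B - P)) +
     h ^+ 3 *: (p2 *: a1 + p1 *: a2 + (h * p2) *: a2).
  exact/product_remainder/poly3_mul.
have hB : N B <= N a0 + L'.
  have -> : B = a0 + (B - a0) by rewrite addrC subrK.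
  rewrite (le_trans (ND _ _)) // lerD2l (le_trans hL) //.
  by rewrite ler_piMr.
have hp : cabs p <= cabs p0 + cabs p1 + cabs p2.
  rewrite /p (le_trans (cabsD _ _)) // lerD //.
    rewrite (le_trans (cabsD _ _)) // lerD2l cabsM.
    by rewrite ler_piMl ?cabs_ge0.
  by rewrite cabsM cabsX ler_piMl ?cabs_ge0.
apply: le_trans (ND _ _) _.
rewrite [X in _ <= X]mulrDl [X in _ <= X + _]mulrDl; apply: lerD.
  apply: le_trans (ND _ _) _; rewrite !NZ; apply: lerD.
    by rewrite mulrAC ler_pM ?cabs_ge0.
  by rewrite -mulrA ler_pM ?cabs_ge0.
rewrite NZ cabsX mulrC ler_wpM2r ?exprn_ge0 //.
apply: le_trans (ND _ _) _; apply: lerD; first exact: ND.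
by rewrite NZ cabsM -mulrA ler_piMl // mulr_ge0 ?cabs_ge0.
Qed.

Lemma pexp3_const a z : pexp3 N (fun=> a) z.
Proof.
exists a, 0, 0, 1 => //; exists 0 => // h _.
by rewrite /poly3 !scaler0 !addr0 subrr N0 // mul0r.
Qed.

Lemma pexp3_add g1 g2 z : pexp3 N g1 z -> pexp3 N g2 z ->
  pexp3 N (fun w => g1 w + g2 w) z.
Proof.
move=> [a0 [a1 [a2 [d d0 [K K0 hK]]]]] [b0 [b1 [b2 [e e0 [L L0 hL]]]]].
exists (a0 + b0), (a1 + b1), (a2 + b2), (Num.min d e).
  by rewrite lt_min d0.
exists (K + L) => [|h]; first exact: addr_ge0.
rewrite lt_min => /andP[/hK {}hK /hL {}hL].
have -> : poly3 h (a0 + b0) (a1 + b1) (a2 + b2) =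
    poly3 h a0 a1 a2 + poly3 h b0 b1 b2.
  by rewrite /poly3 !scalerDr !addrA [LHS](ACl (1*3*5*2*4*6)).
rewrite opprD addrACA mulrDl (le_trans (ND _ _)) //.
exact: lerD.
Qed.

Lemma pexp3_sum (I : Type) (r : seq I) (F : I -> C -> E) z :
  (forall i, pexp3 N (F i) z) -> pexp3 N (fun w => \sum_(i <- r) F i w) z.
Proof.
move=> h; elim: r => [|i r IH].
  have -> : (fun w => \sum_(i <- [::]) F i w) = fun=> 0.
    by apply/funext => w; rewrite big_nil.
  exact: pexp3_const.
have -> : (fun w => \sum_(j <- i :: r) F j w) =
    fun w => F i w + \sum_(j <- r) F j w.
  by apply/funext => w; rewrite big_cons.
exact: pexp3_add.
Qed.

Lemma pexp3_scaleX l g z : pexp3 N g z -> pexp3 N (fun w => w ^+ l *: g w) z.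
Proof.
move=> gz; elim: l => [|l IH].
  have -> // : (fun w => w ^+ 0 *: g w) = g.
  by apply/funext => w; rewrite expr0 scale1r.
have -> : (fun w => w ^+ l.+1 *: g w) = (fun w => w *: (w ^+ l *: g w)).
  by apply/funext => w; rewrite scalerA exprS.
by apply: pexp3_scale IH; exact: sexp3_id.
Qed.

Lemma pexp3_scaleXV l g z : z != 0 -> pexp3 N g z ->
  pexp3 N (fun w => w ^- l *: g w) z.
Proof.
move=> z0 gz; elim: l => [|l IH].
  have -> // : (fun w => w ^- 0 *: g w) = g.
  by apply/funext => w; rewrite expr0 invr1 scale1r.
have -> : (fun w => w ^- l.+1 *: g w) = (fun w => w^-1 *: (w ^- l *: g w)).
  by apply/funext => w; rewrite scalerA exprS invfM.
by apply: pexp3_scale IH; exact: sexp3_inv.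
Qed.

Lemma pexp3_dil g c z : c != 0 -> pexp3 N g (c * z) ->
  pexp3 N (fun w => g (c * w)) z.
Proof.
move=> c0 [a0 [a1 [a2 [d d0 [K K0 hK]]]]].
have cc : 0 < cabs c by rewrite cabs_gt0.
exists a0, (c *: a1), (c ^+ 2 *: a2), (d / cabs c); first by rewrite divr_gt0.
exists (K * cabs c ^+ 3) => [|h]; first by rewrite mulr_ge0 // exprn_ge0 // ltW.
rewrite ltr_pdivlMr // mulrC -cabsM => /hK; rewrite mulrDr cabsM exprMn mulrA.
by rewrite /poly3 !scalerA exprMn ![c * _]mulrC ![c ^+ 2 * _]mulrC.
Qed.

Lemma pexp3_near g1 g2 z (d : R) : 0 < d ->
  (forall h, cabs h < d -> g1 (z + h) = g2 (z + h)) ->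
  pexp3 N g1 z -> pexp3 N g2 z.
Proof.
move=> d0 e [a0 [a1 [a2 [d' d'0 [K K0 hK]]]]]; exists a0, a1, a2, (Num.min d d').
  by rewrite lt_min d0.
by exists K => // h; rewrite lt_min => /andP[/e <- /hK].
Qed.

(** An asymptotic expansion: d and K may depend on the order n, so convergence of the series is not
    implied. *)
Definition pexp (g : C -> E) (z : C) (a : nat -> E) := forall n : nat,
  exists2 d : R, 0 < d & exists2 K : R, 0 <= K & forall h, cabs h < d ->
    N (g (z + h) - \sum_(l < n) h ^+ l *: a l) <= K * cabs h ^+ n.

Lemma pexp_pexp3 g z a : pexp g z a -> pexp3 N g z.
Proof.
move=> /(_ 3)[d d0 [K K0 hK]]; exists (a 0%N), (a 1%N), (a 2%N), d => //.
exists K => // h /hK; rewrite !big_ord_recr big_ord0 /= add0r expr0 scale1r.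
by rewrite expr1.
Qed.

Lemma pexp_uniq g z a b : pexp g z a -> pexp g z b -> a =1 b.
Proof.
move=> ga gb n; elim/ltn_ind: n => n IH.
have [d d0 [K K0 hK]] := ga n.+1; have [e e0 [L L0 hL]] := gb n.+1.
apply/eqP; rewrite -subr_eq0; apply/eqP/N_eq0/eqP.
rewrite eq_le N_ge0 andbT leNgt; apply/negP => ab.
(* Comparing the expansions gives N (a n - b n) <= (K + L) t; the second bound on t makes the right
   side at most half of the left. *)
pose t := Num.min (Num.min d e / 2) (N (a n - b n) / (2 * (K + L + 1))).
have KL : 0 < K + L + 1 by rewrite ltr_wpDl // addr_ge0.
have t0 : 0 < t by rewrite !lt_min !divr_gt0 ?lt_min ?d0 ?mulr_gt0.
have ct : cabs t%:C%C = t by rewrite cabs_real gtr0_norm.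
have tde : t < d /\ t < e.
  have : t <= Num.min d e / 2 by rewrite ge_min lexx.
  have : Num.min d e <= d by rewrite ge_min lexx.
  have : Num.min d e <= e by rewrite ge_min lexx orbT.
  by split; lra.
have := hK t%:C%C; have := hL t%:C%C; rewrite ct => /(_ tde.2) + /(_ tde.1).
set G := g _; rewrite !big_ord_recr /=.
have -> : \sum_(i < n) t%:C%C ^+ i *: a i = \sum_(i < n) t%:C%C ^+ i *: b i.
  by apply: eq_bigr => i _; rewrite IH.
set S := \sum_(_ < _) _ => h1 h2.
have h3 : N (t%:C%C ^+ n *: (a n - b n)) <= (K + L) * t ^+ n.+1.
  have -> : t%:C%C ^+ n *: (a n - b n) = (G - (S + t%:C%C ^+ n *: b n)) -
      (G - (S + t%:C%C ^+ n *: a n)).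
    set A := _ *: a n; set B := _ *: b n.
    rewrite opprB [RHS]addrC [RHS]addrA subrK [- (S + B)]opprD addrACA subrr.
    by rewrite add0r scalerBr.
  by rewrite (le_trans (NB NZ ND _ _)) // addrC mulrDl lerD.
move: h3; rewrite NZ cabsX ct exprS mulrA [_ * t ^+ n]mulrC.
rewrite ler_pM2l ?exprn_gt0 // => h3.
have : t <= N (a n - b n) / (2 * (K + L + 1)) by rewrite ge_min lexx orbT.
rewrite ler_pdivlMr ?mulr_gt0 // => h4.
have : (K + L) * t <= t * (K + L + 1) by rewrite mulrC ler_pM2l // lerDl.
lra.
Qed.

End InSpace.
End Expansions.

(** * Discrete Fourier averages, Taylor remainders, Liouville's theorem *)

Section PowerSeries.
Context {R : realType} {E : lmodType R[i]} (N : E -> R).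
Local Notation C := R[i].
Hypotheses (N_ge0 : forall x, 0 <= N x) (N_eq0 : forall x, N x = 0 -> x = 0)
  (NZ : forall (c : C) x, N (c *: x) = cabs c * N x)
  (ND : forall x y, N (x + y) <= N x + N y).

(* The j-th discrete Fourier coefficient of x over the (n+1)-st roots of unity. *)
Definition avg n (w : C) (j : nat) (x : nat -> E) : E :=
  (n.+1%:R)^-1 *: \sum_(k < n.+1) (w^-1 ^+ (j * k)) *: x k.

Lemma N_avg n w j x (B : R) : n.+1.-primitive_root w ->
  (forall k, N (x k) <= B) -> N (avg n w j x) <= B.
Proof.
move=> pw xB; have cw := cabs_prim_root pw.
rewrite /avg NZ cabsV cabs_nat ler_pdivrMl ?ltr0n //.
apply: le_trans (N_sum NZ ND _ _ _) _.
have -> : n.+1%:R * B = \sum_(k < n.+1) B by rewrite sumr_const card_ord mulr_natl.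
apply: ler_sum => k _.
by rewrite NZ cabsX cabsV cw invr1 expr1n mul1r.
Qed.

Lemma avg_sum n (w h : C) j m (a : nat -> E) :
  avg n w j (fun k => \sum_(l < m) (w ^+ k * h) ^+ l *: a l) =
  \sum_(l < m) h ^+ l *: (((n.+1%:R)^-1 *
     \sum_(k < n.+1) (w^-1) ^+ (j * k) * w ^+ (l * k)) *: a l).
Proof.
rewrite /avg; under eq_bigr do rewrite scaler_sumr.
rewrite exchange_big scaler_sumr; apply: eq_bigr => l _ /=.
rewrite [RHS]scalerA mulrCA -[RHS]scalerA; congr (_ *: _).
rewrite mulr_sumr scaler_suml; apply: eq_bigr => k _.
rewrite scalerA; congr (_ *: _).
by rewrite exprMn -exprM [(k * l)%N]mulnC mulrA mulrC.
Qed.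

Lemma avg_coef n (w h : C) j (a : nat -> E) : n.+1.-primitive_root w ->
  (j < n.+1)%N ->
  avg n w j (fun k => \sum_(l < n.+1) (w ^+ k * h) ^+ l *: a l) = h ^+ j *: a j.
Proof.
move=> pw jn; rewrite avg_sum (bigD1 (Ordinal jn)) //= prim_root_orth //.
rewrite eqxx scale1r big1 ?addr0 // => l; rewrite -val_eqE /= => lj.
by rewrite prim_root_orth // (negbTE lj) scale0r scaler0.
Qed.

Lemma coef_bound n (b : nat -> E) (rho B : R) j : 0 <= rho -> (j < n.+1)%N ->
  (forall h, cabs h = rho -> N (\sum_(l < n.+1) h ^+ l *: b l) <= B) ->
  rho ^+ j * N (b j) <= B.
Proof.
move=> r0 jn hB; have [w pw] := @prim_root_exists R n.
have <- : N ((rho%:C%C : C) ^+ j *: b j) = rho ^+ j * N (b j).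
  by rewrite NZ cabsX cabs_real ger0_norm.
rewrite -(avg_coef rho%:C%C b pw jn); apply: N_avg => // k.
apply: hB; rewrite cabsM cabsX (cabs_prim_root pw) expr1n mul1r cabs_real.
by rewrite ger0_norm.
Qed.

(** Lagrange interpolation at the roots of unity. The weights depend on z alone, so the regularity
    of a polynomial in further parameters follows from that of finitely many values. *)
Lemma interpolation n (w : C) (a : nat -> E) z : n.+1.-primitive_root w ->
  \sum_(l < n.+1) z ^+ l *: a l =
  \sum_(k < n.+1) ((n.+1%:R)^-1 * \sum_(j < n.+1) w^-1 ^+ (j * k) * z ^+ j) *:
    (\sum_(l < n.+1) (w ^+ k) ^+ l *: a l).
Proof.
move=> pw.
have aE (j : 'I_n.+1) : a j = avg n w j (fun k => \sum_(l < n.+1) (w ^+ k) ^+ l *: a l).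
  rewrite -[LHS]scale1r -(expr1n _ j) -(avg_coef 1 a pw (ltn_ord j)).
  by congr avg; apply/funext => k; apply: eq_bigr => l _; rewrite mulr1.
under eq_bigr do rewrite aE.
rewrite /avg; under eq_bigr do rewrite scalerA mulrC -scalerA scaler_sumr.
rewrite -scaler_sumr exchange_big scaler_sumr; apply: eq_bigr => k _ /=.
rewrite -scalerA scaler_suml; congr (_ *: _); apply: eq_bigr => j _.
by rewrite scalerA mulrC.
Qed.

Lemma poly3_0 (a0 a1 a2 : E) : poly3 0 a0 a1 a2 = a0.
Proof. by rewrite /poly3 expr0n /= !scale0r !addr0. Qed.

Lemma pexp_at0 (g : C -> E) z a : pexp N g z a -> g z = a 0%N.
Proof.
move=> /(_ 1%N)[d d0 [K _ /(_ 0)]]; rewrite cabs0 addr0 => /(_ d0).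
rewrite big_ord1 expr0 scale1r mulr0 => h.
by apply/eqP; rewrite -subr_eq0; apply/eqP/N_eq0/eqP; rewrite eq_le h N_ge0.
Qed.

(** A Schwarz lemma: q, the remainder divided by z^n and completed by a n at 0, still has
    third-order expansions, so the maximum principle applies to it. At 0 this uses the expansion of
    g to order n+3. The value of q at 0 bounds a n. *)
Lemma remainder_bound (g : C -> E) a (r M : R) n : 0 < r -> pexp N g 0 a ->
  (forall z, cabs z <= r -> pexp3 N g z) ->
  (forall z, cabs z = r -> N (g z - \sum_(l < n) z ^+ l *: a l) <= M) ->
  (forall z, cabs z <= r ->
     N (g z - \sum_(l < n) z ^+ l *: a l) <= M * (cabs z / r) ^+ n) /\
  N (a n) <= M / r ^+ n.
Proof.
move=> r0 ga g3 gM; pose S z := \sum_(l < n) z ^+ l *: a l.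
pose q z := if z == 0 then a n else z ^- n *: (g z - S z).
have rn : 0 < r ^+ n by rewrite exprn_gt0.
have q3 z : cabs z <= r -> pexp3 N q z.
  move=> zr; have [->|z0] := eqVneq z 0.
    exists (a n), (a n.+1), (a n.+2); have [d d0 [K K0 hK]] := ga n.+3.
    exists d => //; exists K => // h /hK; rewrite !add0r /q.
    have [->|h0] := eqVneq h 0.
      by move=> _; rewrite poly3_0 subrr (N0 NZ) mulr_ge0 // exprn_ge0 // cabs_ge0.
    have ch : 0 < cabs h by rewrite cabs_gt0.
    have hn : h ^+ n != 0 by rewrite expf_neq0.
    have -> : poly3 h (a n) (a n.+1) (a n.+2) = h ^- n *:
        (h ^+ n *: a n + h ^+ n.+1 *: a n.+1 + h ^+ n.+2 *: a n.+2).
      have e1 : h ^- n * h ^+ n.+1 = h by rewrite exprSr mulKf.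
      have e2 : h ^- n * h ^+ n.+2 = h ^+ 2 by rewrite -addn2 exprD mulKf.
      by rewrite /poly3 !scalerDr !scalerA mulVf // scale1r e1 e2.
    rewrite -scalerBr -addrA -opprD !big_ord_recr /= -/(S h) -!addrA.
    rewrite NZ cabsV cabsX ler_pdivrMl ?exprn_gt0 // => /le_trans; apply.
    by rewrite [X in _ <= X]mulrCA -exprD addn3.
  have cz : 0 < cabs z by rewrite cabs_gt0.
  apply: (@pexp3_near _ _ N (fun w => w ^- n *: (g w + \sum_(l < n) w ^+ l *: - a l)) _ _ (cabs z)) => //.
    move=> h hz; rewrite /q ifF; last first.
      apply/negbTE/eqP => zh; have : cabs z = cabs h.
        by rewrite -(cabsN h); congr cabs; apply/eqP; rewrite -addr_eq0 zh.
      by move=> e; rewrite e ltxx in hz.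
    congr (_ *: (_ + _)); rewrite /S -sumrN; apply: eq_bigr => l _.
    by rewrite scalerN.
  apply: pexp3_scaleXV => //; apply: pexp3_add => //; first exact: g3.
  by apply: pexp3_sum => // l; apply: pexp3_scaleX => //; exact: pexp3_const.
have qM z : cabs z <= r -> N (q z) <= M / r ^+ n.
  apply: (max_modulus N_ge0 N_eq0 NZ ND r0 q3) => {}z zr.
  have z0 : z != 0 by rewrite -cabs_gt0 zr.
  rewrite /q (negbTE z0) NZ cabsV cabsX zr mulrC ler_pM2r ?invr_gt0 //.
  exact: gM.
have q0 : N (q 0) <= M / r ^+ n by apply: qM; rewrite cabs0 ltW.
split; last by move: q0; rewrite /q eqxx.
move=> z zr; have := qM z zr; rewrite /q; case: eqP => [->|/eqP z0] hq.
  rewrite cabs0 mul0r; have [n0|n0] := posnP n.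
    move: hq; rewrite n0 big_ord0 subr0 !expr0 divr1 mulr1.
    by rewrite (pexp_at0 ga).
  have [d d0 [K _ /(_ 0)]] := ga n; rewrite cabs0 addr0 => /(_ d0).
  by rewrite expr0n (gtn_eqF n0) !mulr0.
have cz : 0 < cabs z by rewrite cabs_gt0.
move: hq; rewrite NZ cabsV cabsX ler_pdivrMl ?exprn_gt0 // => /le_trans; apply.
by rewrite expr_div_n mulrC mulrAC mulrA.
Qed.

(** To use [remainder_bound] at order j, the coefficients below j must be removed from the bound on
    the circle. Fourier averaging over rotations by the (j+1)-st roots of unity kills them, keeps a
    j, and preserves the bound M. *)
Lemma cauchy_estimate (g : C -> E) a (r M : R) j : 0 < r -> pexp N g 0 a ->
  (forall z, cabs z <= r -> pexp3 N g z) ->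
  (forall z, cabs z = r -> N (g z) <= M) -> N (a j) <= M / r ^+ j.
Proof.
move=> r0 ga g3 gM; have [w pw] := @prim_root_exists R j.
have cw := cabs_prim_root pw.
have w0 : w != 0 by rewrite -cabs_gt0 cw.
have cwk k z : cabs (w ^+ k * z) = cabs z by rewrite cabsM cabsX cw expr1n mul1r.
pose G z := avg j w j (fun k => g (w ^+ k * z)).
pose b l := ((j.+1%:R)^-1 *
     \sum_(k < j.+1) (w^-1) ^+ (j * k) * w ^+ (l * k)) *: a l.
have bj : b j = a j by rewrite /b prim_root_orth // eqxx scale1r.
have bl l : (l < j)%N -> b l = 0.
  move=> lj; rewrite /b prim_root_orth // ?scale0r // ?ltnS 1?ltnW //.
  by rewrite (ltn_eqF lj) scale0r.
have Gb : pexp N G 0 b.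
  move=> n; have [d d0 [K K0 hK]] := ga n; exists d => //; exists K => // h hd.
  rewrite add0r -(avg_sum j w h j n a) /G /avg -scalerBr -sumrB.
  under eq_bigr do rewrite -scalerBr.
  apply: (@N_avg j w j (fun k => g (w ^+ k * h) -
    \sum_(l < n) (w ^+ k * h) ^+ l *: a l)) => // k.
  by have := hK (w ^+ k * h); rewrite cwk add0r; apply.
rewrite -bj; apply: (proj2 (@remainder_bound G b r M j r0 Gb _ _)).
  move=> z zr; apply: (pexp3_scale N_ge0 N_eq0 NZ ND (phi := fun=> (j.+1%:R)^-1)).
    exact: sexp3_const.
  apply: pexp3_sum => // k.
  apply: (pexp3_scale N_ge0 N_eq0 NZ ND (phi := fun=> w^-1 ^+ (j * k))).
    exact: sexp3_const.
  by apply: pexp3_dil; [rewrite expf_neq0 | apply: g3; rewrite cwk].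
move=> z zr; rewrite big1 ?subr0 => [|l _]; last by rewrite bl // scaler0.
by apply: N_avg => // k; apply: gM; rewrite cwk.
Qed.

(** On the circle g and each of the n Taylor terms contribute at most M, the latter by the Cauchy
    estimates; hence the factor n+1. Its linear growth is harmless against the geometric factor. *)
Lemma taylor_disc (g : C -> E) a (r M : R) n z : 0 < r -> pexp N g 0 a ->
  (forall z, cabs z <= r -> pexp3 N g z) ->
  (forall z, cabs z = r -> N (g z) <= M) -> cabs z <= r ->
  N (g z - \sum_(l < n) z ^+ l *: a l) <= n.+1%:R * M * (cabs z / r) ^+ n.
Proof.
move=> r0 ga g3 gM; apply: (proj1 (@remainder_bound g a r _ n r0 ga g3 _)).
move=> {}z zr; apply: le_trans (NB NZ ND _ _) _.
rewrite -addn1 addnC natrD mulrDl mul1r lerD //; first exact: gM.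
apply: le_trans (N_sum NZ ND _ _ _) _.
have -> : n%:R * M = \sum_(l < n) M by rewrite sumr_const card_ord mulr_natl.
apply: ler_sum => l _; rewrite NZ cabsX zr mulrC -ler_pdivlMr ?exprn_gt0 //.
exact: cauchy_estimate ga g3 gM.
Qed.

(** Liouville's theorem: for growth of degree n, the remainder bound of order n+1 on the disc of
    radius r decays like 1/r. *)
Lemma entire_poly (g : C -> E) a (r0 M : R) n :
  pexp N g 0 a -> (forall z, pexp3 N g z) ->
  (forall z, r0 <= cabs z -> N (g z) <= M * cabs z ^+ n) ->
  forall z, g z = \sum_(l < n.+1) z ^+ l *: a l.
Proof.
move=> ga g3 gM z; set S := \sum_(_ < _) _.
apply/eqP; rewrite -subr_eq0; apply/eqP/N_eq0/eqP.
rewrite eq_le N_ge0 andbT leNgt; apply/negP => D0; set D := N _ in D0.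
pose B := n.+2%:R * `|M| * cabs z ^+ n.+1.
have B0 : 0 <= B by rewrite !mulr_ge0 // exprn_ge0 // cabs_ge0.
(* Large enough to exceed |z| and r0, and to make D r > B, against the bound D <= B / r. *)
pose r := 1 + `|r0| + cabs z + B / D.
have BD : 0 <= B / D by rewrite divr_ge0 // ltW.
have r1 : 0 < r by rewrite /r; have := cabs_ge0 z; have := normr_ge0 r0; lra.
have zr : cabs z <= r by rewrite /r; have := normr_ge0 r0; lra.
have gr w : cabs w = r -> N (g w) <= `|M| * r ^+ n.
  move=> wr; apply: le_trans (gM w _) _.
    rewrite wr /r; have := ler_norm r0; have := cabs_ge0 z; lra.
  by rewrite wr ler_wpM2r ?ler_norm // exprn_ge0 // ltW.
have := @taylor_disc g a r _ n.+1 z r1 ga (fun w _ => g3 w) gr zr.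
have -> : n.+2%:R * (`|M| * r ^+ n) * (cabs z / r) ^+ n.+1 = B / r.
  by rewrite /B expr_div_n [r ^+ n.+1]exprS; field; rewrite expf_neq0 gt_eqF.
rewrite -/S -/D => hD.
have : D * r <= B by rewrite -ler_pdivlMr.
have -> : D * r = D * (1 + `|r0| + cabs z) + B.
  by rewrite /r; field; rewrite gt_eqF.
have : 0 < D * (1 + `|r0| + cabs z).
  by rewrite mulr_gt0 //; have := cabs_ge0 z; have := normr_ge0 r0; lra.
lra.
Qed.

Lemma pexp_translate (g : C -> E) z w a : pexp N g (z + w) a ->
  pexp N (fun h => g (z + h)) w a.
Proof.
move=> ga n; have [d d0 [K K0 hK]] := ga n; exists d => //; exists K => // h.
by rewrite addrA; exact: hK.
Qed.

Lemma pexp3_shift (g : C -> E) z w : pexp3 N g (z + w) ->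
  pexp3 N (fun h => g (z + h)) w.
Proof.
move=> [a0 [a1 [a2 [d d0 [K K0 hK]]]]]; exists a0, a1, a2, d => //.
by exists K => // h; rewrite addrA; exact: hK.
Qed.

Lemma disc_bounded (g : C -> E) (r : R) : 0 <= r ->
  (forall z, cabs z <= r -> pexp3 N g z) ->
  exists2 M : R, 0 <= M & forall z, cabs z <= r -> N (g z) <= M.
Proof.
move=> r0 g3; have [|z0 _ h] := @disc_max R r (fun z => N (g z)) r0; last by exists (N (g z0)).
move=> z zr e e0; have [d /andP[d0 d1] [L L0 hL]] := pexp3_lip N_ge0 N_eq0 NZ ND (g3 z zr).
have L1 : 0 < L + 1 by rewrite ltr_wpDl.
exists (Num.min d (e / (L + 1))); first by rewrite lt_min d0 divr_gt0.
move=> w; rewrite lt_min => /andP[wd]; rewrite ltr_pdivlMr // => we.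
have := hL _ wd; rewrite [z + _]addrC subrK => hw.
have -> : g w = g z + (g w - g z) by rewrite addrC subrK.
apply: le_lt_trans (ND _ _) _; rewrite ltrD2l; apply: le_lt_trans hw _.
by have := cabs_ge0 (w - z); lra.
Qed.

Lemma binomial_shift n (t h : C) (a : nat -> E) :
  \sum_(i < n) (t + h) ^+ i *: a i =
  \sum_(l < n) h ^+ l *: \sum_(i < n) (t ^+ (i - l) *+ 'C(i, l)) *: a i.
Proof.
under [RHS]eq_bigr do rewrite scaler_sumr.
rewrite exchange_big; apply: eq_bigr => i _ /=; rewrite exprDn scaler_suml.
rewrite (big_ord_widen n (fun l => (t ^+ (i - l) * h ^+ l *+ 'C(i, l)) *: a i)) //.
rewrite big_mkcond; apply: eq_bigr => l _; rewrite scalerA mulrnAr [h ^+ l * _]mulrC.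
by case: ltnP => // il; rewrite bin_small // mulr0n scale0r.
Qed.

(* Comparing the expansions at 0 and at t, on the circle |h| = |t|, gives
   a t j - a 0 j - (j+1) t a 0 (j+1) = O(t^2). *)
Lemma pexp_deriv (g : C -> E) (a : C -> nat -> E) (r : R) j : 0 < r ->
  (forall t, cabs t <= r -> pexp N g t (a t)) ->
  exists2 d : R, 0 < d & exists2 K : R, 0 <= K & forall t, cabs t < d ->
    N (a t j - a 0 j - t *: (j.+1%:R *: a 0 j.+1)) <= K * cabs t ^+ 2.
Proof.
move=> r0 ga; have g3 z : cabs z <= r -> pexp3 N g z by move=> /ga/pexp_pexp3.
have [M M0 gM] := disc_bounded (ltW r0) g3.
pose rho := r / 2; have rho0 : 0 < rho by rewrite divr_gt0.
pose n := j.+2; pose L := n.+1%:R * M / rho ^+ n.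
have L0 : 0 <= L by rewrite divr_ge0 ?exprn_ge0 ?mulr_ge0 // ltW.
(* One constant L serves all centres t with |t| <= rho, because the discs of radius rho about them
   stay in the disc of radius r, where g is bounded by M. *)
have rem t h : cabs t <= rho -> cabs h <= rho ->
    N (g (t + h) - \sum_(l < n) h ^+ l *: a t l) <= L * cabs h ^+ n.
  move=> tr hr; have th w : cabs w <= rho -> cabs (t + w) <= r.
    move=> wr; rewrite (le_trans (cabsD _ _)) //.
    by move: tr wr; rewrite /rho; lra.
  have tr' : cabs t <= r by rewrite (le_trans tr) // /rho; lra.
  have gt : pexp N g (t + 0) (a t) by rewrite addr0; exact: ga.
  have := @taylor_disc (fun w => g (t + w)) (a t) rho M n h rho0
    (pexp_translate gt).
  rewrite expr_div_n mulrA -[X in _ -> _ -> _ -> _ <= X]mulrAC; apply => //.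
    by move=> z zr; apply/pexp3_shift/g3/th.
  by move=> z zr; apply/gM/th; rewrite zr.
exists (rho / 2); first by rewrite divr_gt0.
exists (L + L * 2 ^+ n) => [|t td]; first by rewrite addr_ge0 // mulr_ge0 // exprn_ge0.
have [->|t0] := eqVneq t 0.
  by rewrite subrr scale0r subr0 (N0 NZ) cabs0 expr0n mulr0.
have ct : 0 < cabs t by rewrite cabs_gt0.
(* The coefficients at t minus those of the Taylor polynomial at 0 re-expanded at t. For l = j only
   i = j and i = j+1 contribute, because n = j+2. *)
pose b l := a t l - \sum_(i < n) (t ^+ (i - l) *+ 'C(i, l)) *: a 0 i.
have bj : b j = a t j - a 0 j - t *: (j.+1%:R *: a 0 j.+1).
  rewrite /b /n !big_ord_recr /= big1 => [|i _]; last first.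
    by rewrite bin_small // mulr0n scale0r.
  rewrite add0r subnn expr0 binn scale1r subSnn expr1 binSn.
  by rewrite opprD addrA scalerA mulr_natr.
rewrite -bj.
have := @coef_bound j.+1 b (cabs t) ((L + L * 2 ^+ n) * cabs t ^+ n) j (ltW ct).
rewrite ltnW ?ltnSn // => /(_ isT) hb.
have {}hb : cabs t ^+ j * N (b j) <= (L + L * 2 ^+ n) * cabs t ^+ n.
  apply: hb => h ht; rewrite -/n.
  have -> : \sum_(l < n) h ^+ l *: b l =
      (g (t + h) - \sum_(i < n) (t + h) ^+ i *: a 0 i) -
      (g (t + h) - \sum_(l < n) h ^+ l *: a t l).
    rewrite opprB [RHS]addrC [RHS]addrA subrK binomial_shift -sumrB.
    by apply: eq_bigr => l _; rewrite -scalerBr.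
  apply: le_trans (NB NZ ND _ _) _; rewrite addrC mulrDl lerD //.
    have tr : cabs t <= rho by lra.
    by have := rem t h tr; rewrite ht; apply.
  have th : cabs (t + h) <= 2 * cabs t.
    by rewrite (le_trans (cabsD _ _)) // ht; lra.
  have := rem 0 (t + h); rewrite cabs0 add0r => /(_ (ltW rho0)).
  have hr : cabs (t + h) <= rho by lra.
  move=> /(_ hr) /le_trans; apply; rewrite -mulrA -exprMn ler_wpM2l //.
  by rewrite lerXn2r ?nnegrE ?cabs_ge0 // mulr_ge0 // ltW.
have tn : cabs t ^+ n = cabs t ^+ j * cabs t ^+ 2 by rewrite -exprD addn2.
by move: hb; rewrite tn [X in _ <= X]mulrCA ler_pM2l ?exprn_gt0.
Qed.

End PowerSeries.

(** * Several variables *)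

HB.instance Definition _ (R : realType) (m n : nat) := Complete.on 'M[R]_(m, n).

Section CoordinateBaire.
Context {R : realType}.
Local Notation C := R[i].

Definition near_row k (d : R) (c c' : 'rV[C]_k) :=
  forall i, cabs (c' 0 i - c 0 i) < d.

Lemma Re_le_cabs (z : C) : `|complex.Re z| <= cabs z.
Proof.
rewrite -(@ler_pXn2r _ 2) ?nnegrE ?cabs_ge0 // real_normK ?num_real //.
by rewrite cabs_sqr lerDl sqr_ge0.
Qed.

Lemma Im_le_cabs (z : C) : `|complex.Im z| <= cabs z.
Proof.
rewrite -(@ler_pXn2r _ 2) ?nnegrE ?cabs_ge0 // real_normK ?num_real //.
by rewrite cabs_sqr lerDr sqr_ge0.
Qed.

Lemma cabs_le_ReIm (z : C) : cabs z <= `|complex.Re z| + `|complex.Im z|.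
Proof.
rewrite [z in X in X <= _]complexE (le_trans (cabsD _ _)) // cabsM !cabs_real.
by rewrite cabs_i mul1r.
Qed.

(** Baire's theorem in C^k, read as R^(2k). Were all the open sets F j dense, a point of the small
    polydisc about 0 would lie in every F j, against the pointwise bound there. A ball that misses
    some F j carries the uniform bound j. *)
Lemma baire_bounded k (p : nat -> 'rV[C]_k -> R) (d0 : R) : 0 < d0 ->
  (forall l c (e : R), 0 < e -> exists2 d : R, 0 < d &
     forall c', near_row d c c' -> `|p l c' - p l c| < e) ->
  (forall c, near_row d0 0 c -> exists M : R, forall l, p l c <= M) ->
  exists c0, exists2 d : R, 0 < d & exists M : R,
    forall c, near_row d c0 c -> forall l, p l c <= M.
Proof.
move=> d00 pc pb; pose U := 'rV[R]_(k + k).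
pose phi (u : U) : 'rV[C]_k :=
  \row_i (u 0 (lshift k i) +i* u 0 (rshift k i))%C.
pose psi (c : 'rV[C]_k) : U :=
  row_mx (\row_i complex.Re (c 0 i)) (\row_i complex.Im (c 0 i)).
have phiK c : phi (psi c) = c.
  apply/rowP => i; rewrite mxE row_mxEl row_mxEr !mxE.
  by case: (c 0 i).
pose F (j : nat) : set U := [set u | (exists i, d0 / 2 < cabs (phi u 0 i)) \/
  (exists l, j%:R < p l (phi u))].
have nearU (u : U) (d : R) : 0 < d -> nbhs u [set v | near_row d (phi u) (phi v)].
  move=> dp; apply/nbhs_ballP; exists (d / 2); first by rewrite /= divr_gt0.
  move=> v [_ uv] i; rewrite !mxE (splitr d).
  have h1 := uv 0 (lshift k i); have h2 := uv 0 (rshift k i).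
  rewrite /ball /= in h1 h2.
  apply: le_lt_trans (cabs_le_ReIm _) _; rewrite /= distrC.
  by rewrite [X in _ + X]distrC ltrD.
have oF j : open (F j).
  rewrite openE => u [[i hi]|[l hl]].
    have e0 : 0 < cabs (phi u 0 i) - d0 / 2 by rewrite subr_gt0.
    apply: filterS (nearU u _ e0) => v /(_ i) hv; left; exists i.
    have := cabsD (phi v 0 i) (phi u 0 i - phi v 0 i).
    by rewrite [phi v 0 i + _]addrC subrK cabs_distC; lra.
  have e0 : 0 < p l (phi u) - j%:R by rewrite subr_gt0.
  have [d dp hd] := pc l (phi u) _ e0.
  apply: filterS (nearU u _ dp) => v /hd; rewrite ltr_norml => /andP[hv _].
  by right; exists l; lra.
have [j] : exists j, ~ dense (F j).
  apply: contrapT => h; have dF j : dense (F j).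
    by apply: contrapT => dj; apply: h; exists j.
  have := @Baire R U F (fun j => conj (oF j) (dF j)).
  move=> /(_ [set v | near_row (d0 / 2) (phi 0) (phi v)]°).
  have nz : nbhs (0 : U) [set v | near_row (d0 / 2) (phi 0) (phi v)].
    by apply: nearU; rewrite divr_gt0.
  case; [by exists 0 | exact: open_interior |].
  move=> v [/interior_subset hv Fv].
  have phi0 : phi 0 = 0 by apply/rowP => i; rewrite !mxE.
  have hv' : near_row d0 0 (phi v).
    by move=> i; have := hv i; rewrite phi0; lra.
  have [M hM] := pb _ hv'.
  have [m hm] : exists m : nat, M <= m%:R.
    by exists (Num.bound `|M|); rewrite (le_trans (ler_norm M)) // ltW // archi_boundP.
  have [[i hi]|[l hl]] := Fv m I.
    by move: hi; have := hv i; rewrite phi0 [(0 : 'rV__) 0 i]mxE subr0; lra.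
  by have := hM l; lra.
move=> /existsNP[D /not_implyP[D0 /not_implyP[oD DF]]].
have [u Du] := D0.
have : nbhs u D by apply: open_nbhs_nbhs.
move=> /nbhs_ballP[e e0 eD]; exists (phi u), e => //; exists j%:R => c cu l.
rewrite leNgt; apply/negP => hl; apply: DF; exists (psi c).
split; last by right; exists l; rewrite phiK.
apply: eD; split => // a b; rewrite (ord1 a) /ball /=.
case: (split_ordP b) => i ->; rewrite ?row_mxEl ?row_mxEr mxE distrC.
  have := le_lt_trans (Re_le_cabs _) (cu i); rewrite mxE.
  by case: (c 0 i).
have := le_lt_trans (Im_le_cabs _) (cu i); rewrite mxE.
by case: (c 0 i).
Qed.

End CoordinateBaire.

(** * Continuity of functions that are polynomial on complex lines *)

Section PolynomialOnLines.
Context {R : realType} {E : lmodType R[i]} (N : E -> R).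
Local Notation C := R[i].
Hypotheses (N_ge0 : forall x, 0 <= N x) (N_eq0 : forall x, N x = 0 -> x = 0)
  (NZ : forall (c : C) x, N (c *: x) = cabs c * N x)
  (ND : forall x y, N (x + y) <= N x + N y).

Definition row_cts k (F : 'rV[C]_k -> E) c := forall e : R, 0 < e ->
  exists2 d : R, 0 < d & forall c', near_row d c c' -> N (F c' - F c) < e.

Lemma row_cts_add k (F G : 'rV[C]_k -> E) c : row_cts F c -> row_cts G c ->
  row_cts (fun c => F c + G c) c.
Proof.
move=> Fc Gc e e0; have e20 : 0 < e / 2 by rewrite divr_gt0.
have [d d0 hd] := Fc _ e20; have [d' d'0 hd'] := Gc _ e20.
exists (Num.min d d'); first by rewrite lt_min d0.
move=> c' cc'; rewrite opprD addrACA (splitr e) (le_lt_trans (ND _ _)) // ltrD //.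
  by apply: hd => i; have := cc' i; rewrite lt_min => /andP[].
by apply: hd' => i; have := cc' i; rewrite lt_min => /andP[].
Qed.

Lemma row_cts_const k x (c : 'rV[C]_k) : row_cts (fun=> x) c.
Proof. by move=> e e0; exists 1 => // c' _; rewrite subrr N0. Qed.

Lemma row_cts_sum k (I : Type) (r : seq I) (F : I -> 'rV[C]_k -> E) c :
  (forall i, row_cts (F i) c) -> row_cts (fun c => \sum_(i <- r) F i c) c.
Proof.
move=> h; elim: r => [|i r IH].
  have -> : (fun c => \sum_(i <- [::]) F i c) = fun=> 0.
    by apply/funext => w; rewrite big_nil.
  exact: row_cts_const.
have -> : (fun c => \sum_(j <- i :: r) F j c) =
    fun c => F i c + \sum_(j <- r) F j c.
  by apply/funext => w; rewrite big_cons.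
exact: row_cts_add.
Qed.

Lemma row_cts_scale k (phi : C -> C) (i : 'I_k) (F : 'rV[C]_k -> E) (c : 'rV[C]_k) :
  (exists2 d : R, 0 < d & exists2 L : R, 0 <= L & forall h, cabs h < d ->
     cabs (phi (c 0 i + h) - phi (c 0 i)) <= L * cabs h) ->
  row_cts F c -> row_cts (fun c => phi (c 0 i) *: F c) c.
Proof.
move=> [d d0 [L L0 hL]] Fc e e0.
pose A := cabs (phi (c 0 i)) + L * d + 1.
have A0 : 0 < A by rewrite ltr_wpDl // addr_ge0 ?cabs_ge0 // mulr_ge0 // ltW.
have eA : 0 < e / 2 / A by rewrite !divr_gt0.
have [d' d'0 hd'] := Fc _ eA.
pose B := (L + 1) * (N (F c) + 1).
have B0 : 0 < B by rewrite mulr_gt0 // ltr_wpDl.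
exists (Num.min d (Num.min d' (e / 2 / B))); first by rewrite !lt_min d0 d'0 !divr_gt0.
move=> c' cc'; have hi := cc' i.
have Fc' : N (F c' - F c) < e / 2 / A.
  by apply: hd' => j; have := cc' j; rewrite !lt_min => /and3P[].
move: hi; rewrite !lt_min => /and3P[hid _ hiB].
have := hL _ hid; rewrite [c 0 i + _]addrC subrK => hp.
set q := phi (c' 0 i) in hp *; set p := phi (c 0 i) in hp *.
set x := cabs (c' 0 i - c 0 i) in hid hiB hp.
have x0 : 0 <= x by exact: cabs_ge0.
have -> : q *: F c' - p *: F c = q *: (F c' - F c) + (q - p) *: F c.
  by rewrite scalerBr scalerBl addrA subrK.
apply: le_lt_trans (ND _ _) _; rewrite !NZ (splitr e) ltrD //.
  have qA : cabs q <= A.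
    have -> : q = p + (q - p) by rewrite addrC subrK.
    rewrite (le_trans (cabsD _ _)) // /A -addrA lerD2l (le_trans hp) //.
    have : L * x <= L * d by rewrite ler_wpM2l // ltW.
    lra.
  apply: (@le_lt_trans _ _ (A * N (F c' - F c))).
    by rewrite ler_wpM2r.
  by rewrite mulrC -ltr_pdivlMr.
apply: (@le_lt_trans _ _ (B * x)).
  rewrite /B; apply: (@le_trans _ _ (L * x * N (F c))); first by rewrite ler_wpM2r.
  have := N_ge0 (F c) => n0; rewrite mulrAC.
  by rewrite ler_wpM2r // ler_pM // lerDl.
by rewrite mulrC -ltr_pdivlMr.
Qed.

(** Induction on the number i of coordinates that vary: [mix i c d] takes these from c and the
    others from d. Interpolation in one more coordinate writes F as a finite sum of scalar weights
    in that coordinate times functions of the previous ones. *)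
Lemma poly_on_lines_cts k (F : 'rV[C]_k -> E) n :
  (forall c c' : 'rV[C]_k, exists a : nat -> E, forall s : C,
     F (c + s *: c') = \sum_(l < n.+1) s ^+ l *: a l) ->
  forall c, row_cts F c.
Proof.
move=> hF c; have [w pw] := @prim_root_exists R n.
pose mix i (c d : 'rV[C]_k) : 'rV[C]_k := \row_(j < k) if (j < i)%N then c 0 j else d 0 j.
suff h i : (i <= k)%N -> forall d, row_cts (fun c => F (mix i c d)) c.
  have := h k (leqnn k) 0; have -> // : (fun c => F (mix k c 0)) = F.
  by apply/funext => c'; congr F; apply/rowP => j; rewrite mxE ltn_ord.
elim: i => [_ d|i IH ik d].
  have -> : (fun c => F (mix 0%N c d)) = fun=> F d.
    by apply/funext => c'; congr F; apply/rowP => j; rewrite mxE.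
  exact: row_cts_const.
pose oi := Ordinal ik.
pose upd (s : C) : 'rV[C]_k := \row_j if j == oi then s else d 0 j.
pose lam (j : 'I_n.+1) (z : C) : C :=
  (n.+1%:R)^-1 * \sum_(l < n.+1) w^-1 ^+ (l * j) * z ^+ l.
have -> : (fun c => F (mix i.+1 c d)) =
    fun c => \sum_(j < n.+1) lam j (c 0 oi) *: F (mix i c (upd (w ^+ j))).
  apply/funext => c'.
  have [a ha] := hF (mix i c' (upd 0)) (delta_mx 0 oi).
  have mixE s : mix i c' (upd s) = mix i c' (upd 0) + s *: delta_mx 0 oi.
    apply/rowP => j; rewrite !mxE eqxx /=; case: (eqVneq j oi) => [->|_].
      by rewrite /= ltnn add0r mulr1.
    by rewrite mulr0 addr0.
  have -> : mix i.+1 c' d = mix i c' (upd (c' 0 oi)).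
    apply/rowP => j; rewrite !mxE ltnS leq_eqVlt -[(j == i :> nat)]/(j == oi).
    by case: eqVneq => [->|_] //=; rewrite ltnn.
  rewrite mixE ha (interpolation a _ pw); apply: eq_bigr => j _.
  by rewrite mixE ha.
apply: row_cts_sum => j; apply: (@row_cts_scale _ (lam j)); last exact/IH/ltnW.
pose b (l : nat) : C^o := (n.+1%:R)^-1 * w^-1 ^+ (l * j).
have lamE z : lam j z = \sum_(l < n.+1) z ^+ l *: b l.
  rewrite /lam mulr_sumr; apply: eq_bigr => l _.
  by rewrite mulrA [RHS]mulrC.
have c0 (x : C^o) : cabs x = 0 -> x = 0 by move/eqP; rewrite cabs_eq0 => /eqP.
(* The weights are polynomials, and [pexp3_lip] in the module [C^o] gives their Lipschitz bound at
   the point. *)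
have p3 : pexp3 (E := C^o) (@cabs R) (lam j : C -> C^o) (c 0 oi).
  have -> : lam j = (fun z => \sum_(l < n.+1) z ^+ l *: b l) :> (C -> C^o).
    exact/funext.
  apply: pexp3_sum; [exact: cabsM | exact: cabsD | move=> l].
  apply: pexp3_scaleX; [exact: cabs_ge0 | exact: c0 | exact: cabsM | exact: cabsD |].
  by apply: pexp3_const; exact: cabsM.
have [d1 /andP[d10 _] [L L0 hL]] := pexp3_lip (E := C^o) (@cabs_ge0 R) c0 (@cabsM R) (@cabsD R) p3.
by exists d1 => //; exists L.
Qed.

End PolynomialOnLines.

(** * Analyticity of nc functions *)

(** An alias of ['M[W]_n] that carries [scmx] as its scaling, so that the results on a module with
    norm function N apply to [nrm]. *)
Definition modmx {R : realType} (W : lmodType R[i]) (n : nat) := 'M[W]_n.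

Section ModuleOfMatrices.
Context {R : realType} (W : lmodType R[i]) (n : nat).
HB.instance Definition _ := GRing.Zmodule.on (modmx W n).
Lemma modmx_scalerA (a b : R[i]) (x : modmx W n) :
  scmx a (scmx b x) = scmx (a * b) x.
Proof. exact: scmxA. Qed.
Lemma modmx_scaler1 : left_id (1 : R[i]) (@scmx R W n n).
Proof. exact: scmx1. Qed.
Lemma modmx_scalerDr : right_distributive (@scmx R W n n) +%R.
Proof. by move=> c x y; rewrite scmxD. Qed.
Lemma modmx_scalerDl (x : modmx W n) :
  {morph (fun c : R[i] => scmx c x) : a b / a + b}.
Proof. by move=> a b; rewrite scmxDl. Qed.
HB.instance Definition _ := GRing.Zmodule_isLmodule.Build R[i] (modmx W n)
  modmx_scalerA modmx_scaler1 modmx_scalerDr modmx_scalerDl.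
End ModuleOfMatrices.

(** * Geometric sums *)

Section Geometric.
Context {R : realType}.

Lemma geometric_le (x : R) n : 0 <= x < 1 -> \sum_(l < n) x ^+ l <= (1 - x)^-1.
Proof.
move=> /andP[x0 x1]; rewrite -[leRHS]mul1r ler_pdivlMr ?subr_gt0 //.
have := subrX1 x n; have := exprn_ge0 n x0; set S := \sum_(_ < _) _; lra.
Qed.

(** With y = sqrt x one has x^n = y^n y^n. One factor absorbs n+1, since (n+1) y^n <= 1 + y + ... +
    y^n <= 1/(1 - y); the other tends to 0. *)
Lemma linear_geometric_cvg (x B e : R) : 0 <= x < 1 -> 0 < e ->
  exists n0 : nat, forall n, (n0 <= n)%N -> n.+1%:R * B * x ^+ n < e.
Proof.
move=> /andP[x0 x1] e0; pose y := Num.sqrt x.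
have y0 : 0 <= y by rewrite sqrtr_ge0.
have yx : y ^+ 2 = x by rewrite sqr_sqrtr.
have y1 : y < 1 by rewrite -(@ltr_pXn2r _ 2) ?nnegrE // yx expr1n.
have y1' : 0 < 1 - y by rewrite subr_gt0.
pose A := (`|B| + 1) / (1 - y).
have A0 : 0 < A by rewrite divr_gt0 // ltr_wpDl.
have : (fun n => y ^+ n) @ \oo --> (0 : R) by apply: cvg_expr; rewrite ger0_norm.
move=> /cvgrPdist_lt /(_ (e / A)) [|n0 _ hn]; first by rewrite divr_gt0.
exists n0 => n n0n; have := hn n n0n.
rewrite /= sub0r normrN ger0_norm ?exprn_ge0 // ltr_pdivlMr // => h.
have h2 : n.+1%:R * y ^+ n <= (1 - y)^-1.
  apply: le_trans (@geometric_le y n.+1 _); last by rewrite y0.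
  have -> : n.+1%:R * y ^+ n = \sum_(l < n.+1) y ^+ n.
    by rewrite sumr_const card_ord mulr_natl.
  apply: ler_sum => l _; rewrite ler_wiXn2l // ?(ltW y1) //.
  by rewrite -ltnS ltn_ord.
apply: le_lt_trans h; rewrite -yx -exprM mulnC exprM expr2.
have -> : n.+1%:R * B * (y ^+ n * y ^+ n) = y ^+ n * (B * (n.+1%:R * y ^+ n)) by ring.
rewrite ler_wpM2l ?exprn_ge0 // /A.
have : B * (n.+1%:R * y ^+ n) <= `|B| * (1 - y)^-1.
  apply: le_trans (_ : `|B| * (n.+1%:R * y ^+ n) <= _); last by rewrite ler_wpM2l.
  by rewrite ler_wpM2r ?ler_norm // mulr_ge0 // exprn_ge0.
have : 0 < (1 - y)^-1 by rewrite invr_gt0.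
lra.
Qed.

End Geometric.

(** * Expansions of [f] on slices and of [DeltaR] on lines of directions *)

Section NCAnalytic.
Context {R : realType} {V : lmodType R[i]} {W : normedModType R[i]}
  {nrm : forall n, 'M[W]_n -> R} {Om : forall n, set 'M[V]_n}
  {f : forall n, 'M[V]_n -> 'M[W]_n}.
Local Notation C := R[i].
Hypotheses (Om_nc : nc_set Om) (Om_open : fin_open Om) (nrm_adm : admissible nrm)
  (f_nc : nc_fun Om f) (f_bdd : loc_bdd_slices Om nrm f).
Local Notation E n := (modmx W n).
Local Notation NE n := (@nrm n : E n -> R).

Let N_ge0 n (x : E n) : 0 <= NE n x. Proof. exact: nrm_ge0. Qed.
Let N_eq0 n (x : E n) : NE n x = 0 -> x = 0. Proof. exact: nrm_eq0. Qed.
Let NZ n (c : C) (x : E n) : NE n (c *: x) = cabs c * NE n x.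
Proof. exact: nrmZ. Qed.
Let ND n (x y : E n) : NE n (x + y) <= NE n x + NE n y.
Proof. exact: nrmD. Qed.

Lemma slice_pexp n (Y Z : 'M[V]_n) (t : C) : Om (Y + scmx t Z) ->
  pexp (NE n) (fun t => f (Y + scmx t Z) : E n) t
    (fun l => DeltaR Om f (Y + scmx t Z) Z l).
Proof.
move=> oY N; have [d d0 [K hK]] := taylor_taylor Om_nc Om_open nrm_adm f_nc f_bdd Z N oY.
exists d => //; exists `|K| => // h /hK[_ hh].
rewrite scmxDl addrA; apply: le_trans hh _.
by rewrite ler_wpM2r ?ler_norm // exprn_ge0 // cabs_ge0.
Qed.

Lemma slice_pexp0 n (Y Z : 'M[V]_n) : Om Y ->
  pexp (NE n) (fun t => f (Y + scmx t Z) : E n) 0 (fun l => DeltaR Om f Y Z l).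
Proof.
by move=> oY; have := @slice_pexp n Y Z 0; rewrite scmx0l addr0; apply.
Qed.

Lemma slice_pexp3 n (Y Z : 'M[V]_n) t : Om (Y + scmx t Z) ->
  pexp3 (NE n) (fun t => f (Y + scmx t Z) : E n) t.
Proof. by move=> /slice_pexp/pexp_pexp3. Qed.

(** Up to the factor c^-l this is the corner block of f at a bidiagonal matrix that is affine in s,
    so it inherits the expansion of a slice of f at the larger size. *)
Lemma DeltaR_line_pexp n (Y Z Z0 : 'M[V]_n) l (s : C) : Om Y ->
  exists a, pexp (NE n) (fun s => DeltaR Om f Y (Z + scmx s Z0) l : E n) s a.
Proof.
move=> oY; have [e e0 oB] := Om_bidiag Om_nc Om_open (Z + scmx s Z0) l oY.
pose c : C := ((e / 2)%:C)%C.
have c0 : c != 0 by rewrite -cabs_gt0 cabs_real gtr0_norm divr_gt0.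
have ce : cabs c < e by rewrite cabs_real gtr0_norm ?divr_gt0 //; lra.
have {}oB := oB _ ce; set X := bidiag _ _ _ in oB.
pose D := tri 0 0 (scmx c Z0) l.
have XD h : X + scmx h D = bidiag Y (scmx c (Z + scmx (s + h) Z0)) l.
  rewrite /X /D !bidiagE; apply/matrixP => i j; rewrite !mxE; case: ifP => _.
    by rewrite !if_same !mxE scaler0 addr0.
  case: ifP; rewrite !mxE ?scaler0 ?addr0 // => _.
  by rewrite [(s + h) *: _]scalerDl addrA [RHS]scalerDr [h *: _]scalerA mulrC
    -[(c * h) *: _]scalerA.
have nN : (n <= \sum_(i < l.+1) n)%N by rewrite big_ord_recl leq_addr.
have [b b0 hb] := nrm_mxsub nrm_adm (@tagnat.Rank l.+1 (fun=> n) ord0)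
  (@tagnat.Rank l.+1 (fun=> n) ord_max) nN.
exists (fun m => scmx (c ^- l) (blockof (DeltaR Om f X D m) ord0 ord_max)).
move=> N; have [d d0 [K hK]] := taylor_taylor Om_nc Om_open nrm_adm f_nc f_bdd D N oB.
exists d => //; exists (cabs (c ^- l) * (b * `|K|)).
  by rewrite !mulr_ge0 ?cabs_ge0 // ltW.
move=> h /hK[]; rewrite XD => oXD hN.
have := DeltaR_scale Om_nc f_nc c0 oXD.
move/(congr1 (scmx (c ^- l))); rewrite scmxA mulVf ?expf_neq0 // scmx1 => ->.
set F := f _ in hN *.
have -> : scmx (c ^- l) (blockof F ord0 ord_max) -
    \sum_(m < N) h ^+ m *: (scmx (c ^- l) (blockof (DeltaR Om f X D m) ord0 ord_max) : E n)
  = scmx (c ^- l) (blockof (F - \sum_(m < N) scmx (h ^+ m) (DeltaR Om f X D m)) ord0 ord_max).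
  apply/matrixP => i j; rewrite /blockof !mxE !summxE scalerBr scaler_sumr.
  congr (_ - _); apply: eq_bigr => m _; rewrite !mxE.
  by rewrite !scalerA mulrC.
rewrite (nrmZ nrm_adm) -mulrA ler_wpM2l ?cabs_ge0 //.
apply: le_trans (hb _) _; rewrite -mulrA ler_pM2l // (le_trans hN) //.
by rewrite ler_wpM2r ?ler_norm // exprn_ge0 // cabs_ge0.
Qed.

(** The expansion of f (Y + u Z) at u = h s is also one in h, and coefficients are unique. The
    radius d / (|s| + 1) covers s = 0 as well. *)
Lemma DeltaR_homogeneous n (Y Z : 'M[V]_n) l (s : C) : Om Y ->
  DeltaR Om f Y (scmx s Z) l = scmx (s ^+ l) (DeltaR Om f Y Z l).
Proof.
move=> oY.
apply: (pexp_uniq (@N_ge0 n) (@N_eq0 n) (@NZ n) (@ND n) (slice_pexp0 (scmx s Z) oY)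
  (b := fun l => s ^+ l *: (DeltaR Om f Y Z l : E n))).
move=> m; have [d d0 [K K0 hK]] := slice_pexp0 Z oY m.
have s1 : 0 < cabs s + 1 by rewrite ltr_wpDl ?cabs_ge0.
exists (d / (cabs s + 1)); first by rewrite divr_gt0.
exists (K * cabs s ^+ m); first by rewrite mulr_ge0 // exprn_ge0 // cabs_ge0.
move=> h; rewrite ltr_pdivlMr // => hd.
have hsd : cabs (h * s) < d.
  by rewrite cabsM; have := cabs_ge0 h; nra.
have := hK _ hsd; rewrite !add0r -scmxA cabsM exprMn mulrA [K * _ * _]mulrAC.
congr (NE n (_ - _) <= _); apply: eq_bigr => i _.
by rewrite scalerA exprMn.
Qed.

(** By homogeneity the value at Z + s Z0 is s^l times the value at Z0 + s^-1 Z, which stays bounded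
    for large s. Growth of degree l and Liouville's theorem give a polynomial. *)
Lemma DeltaR_line_poly n (Y Z Z0 : 'M[V]_n) l : Om Y ->
  exists a : nat -> E n, forall s : C,
    (DeltaR Om f Y (Z + scmx s Z0) l : E n) = \sum_(j < l.+1) s ^+ j *: a j.
Proof.
move=> oY; have [a ha] := DeltaR_line_pexp Z Z0 l 0 oY.
have [b hb] := DeltaR_line_pexp Z0 Z l 0 oY.
exists a; have [d /andP[d0 d1] [L L0 hL]] :=
  pexp3_lip (@N_ge0 n) (@N_eq0 n) (@NZ n) (@ND n) (pexp_pexp3 hb).
apply: (@entire_poly _ _ _ (@N_ge0 n) (@N_eq0 n) (@NZ n) (@ND n) _ a (2 / d)
  (NE n (DeltaR Om f Y Z0 l) + L)) => //.
  by move=> z; have [a' /pexp_pexp3] := DeltaR_line_pexp Z Z0 l z oY.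
move=> z zd; have z0 : 0 < cabs z by apply: lt_le_trans zd; rewrite divr_gt0.
have zn : z != 0 by rewrite -cabs_gt0.
have -> : Z + scmx z Z0 = scmx z (Z0 + scmx z^-1 Z).
  by rewrite scmxD scmxA divff // scmx1 addrC.
rewrite DeltaR_homogeneous // (nrmZ nrm_adm) cabsX mulrC.
rewrite ler_wpM2r ?exprn_ge0 ?cabs_ge0 //.
have zi : cabs z^-1 < d.
  rewrite cabsV -[d]invrK ltf_pV2 ?posrE ?invr_gt0 //.
  by apply: lt_le_trans zd; rewrite ltr_pMl ?invr_gt0 //; lra.
have := hL _ zi; rewrite add0r scmx0l addr0.
set A := DeltaR _ _ _ _ _; set B := DeltaR _ _ _ _ _ => h.
have -> : A = B + (A - B) by rewrite addrC subrK.
rewrite (le_trans (nrmD nrm_adm _ _)) // lerD2l (le_trans h) //.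
by rewrite ler_piMr // ltW // (lt_le_trans zi).
Qed.

End NCAnalytic.

(** * Uniform bounds on the coefficients and continuity of [f] *)

Section NCContinuity.
Context {R : realType} {V : lmodType R[i]} {W : normedModType R[i]}
  {nrm : forall n, 'M[W]_n -> R} {Om : forall n, set 'M[V]_n}
  {f : forall n, 'M[V]_n -> 'M[W]_n}.
Local Notation C := R[i].
Hypotheses (Om_nc : nc_set Om) (Om_open : fin_open Om) (nrm_adm : admissible nrm)
  (f_nc : nc_fun Om f) (f_bdd : loc_bdd_slices Om nrm f).
Local Notation E n := (modmx W n).
Local Notation NE n := (@nrm n : E n -> R).

Let N_ge0 n (x : E n) : 0 <= NE n x. Proof. exact: nrm_ge0. Qed.
Let N_eq0 n (x : E n) : NE n x = 0 -> x = 0. Proof. exact: nrm_eq0. Qed.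
Let NZ n (c : C) (x : E n) : NE n (c *: x) = cabs c * NE n x.
Proof. exact: nrmZ. Qed.
Let ND n (x y : E n) : NE n (x + y) <= NE n x + NE n y.
Proof. exact: nrmD. Qed.

Lemma slice_estimates n (Y Z : 'M[V]_n) (r M : R) : 0 < r ->
  (forall t, cabs t <= r -> Om (Y + scmx t Z)) ->
  (forall t, cabs t = r -> nrm (f (Y + scmx t Z)) <= M) ->
  (forall l, nrm (DeltaR Om f Y Z l) <= M / r ^+ l) /\
  (forall L t, cabs t <= r ->
     nrm (f (Y + scmx t Z) - \sum_(l < L) scmx (t ^+ l) (DeltaR Om f Y Z l))
       <= L.+1%:R * M * (cabs t / r) ^+ L).
Proof.
move=> r0 oY fM; have oY0 : Om Y.
  by have := oY 0; rewrite cabs0 scmx0l addr0; apply; exact: ltW.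
have g3 t : cabs t <= r -> pexp3 (NE n) (fun t => f (Y + scmx t Z) : E n) t.
  by move=> /oY; exact: slice_pexp3.
have g0 := slice_pexp0 Om_nc Om_open nrm_adm f_nc f_bdd Z oY0.
split=> [l|L t tr].
  exact: (cauchy_estimate (@N_ge0 n) (@N_eq0 n) (@NZ n) (@ND n) l r0 g0 g3 fM).
exact: (taylor_disc (@N_ge0 n) (@N_eq0 n) (@NZ n) (@ND n) L r0 g0 g3 fM tr).
Qed.

(* Baire gives a bound on a ball centred at some c0; homogeneity and the maximum
   principle for s |-> P (c + s c0) move the centre to 0. *)
Lemma DeltaR_bounded_near n (Y : 'M[V]_n) k (Zs : 'I_k -> 'M[V]_n) : Om Y ->
  exists2 d : R, 0 < d & exists2 M : R, 0 <= M & forall c : 'rV[C]_k,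
    near_row d 0 c -> forall l, nrm (DeltaR Om f Y (lincomb c Zs) l) <= M.
Proof.
move=> oY; have [d0 d00 hd0] := fin_open_near Zs (@Om_open _) oY.
pose P l (c : 'rV[C]_k) : E n := DeltaR Om f Y (lincomb c Zs) l.
have Pline l (c c' : 'rV[C]_k) : exists a : nat -> E n, forall s : C,
    P l (c + s *: c') = \sum_(j < l.+1) s ^+ j *: a j.
  have [a ha] := DeltaR_line_poly Om_nc Om_open nrm_adm f_nc f_bdd
    (lincomb c Zs) (lincomb c' Zs) l oY.
  by exists a => s; rewrite /P lincombD lincombZ ha.
have Pc l c (e : R) : 0 < e -> exists2 d : R, 0 < d &
    forall c', near_row d c c' -> `|NE n (P l c') - NE n (P l c)| < e.
  move=> e0; have [d dp hd] := poly_on_lines_cts (@N_ge0 n) (@NZ n) (@ND n)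
    (Pline l) c e0.
  exists d => // c' /hd; apply: le_lt_trans; rewrite ler_norml.
  have h1 := ND (P l c' - P l c) (P l c); rewrite subrK in h1.
  have h2 := ND (P l c - P l c') (P l c'); rewrite subrK in h2.
  have h3 := N_distC (@NZ n) (P l c) (P l c').
  by apply/andP; split; lra.
have Pb c : near_row d0 0 c -> exists M : R, forall l, NE n (P l c) <= M.
  move=> cd; have oc t : cabs t <= 1 -> Om (Y + scmx t (lincomb c Zs)).
    move=> t1; rewrite -lincombZ; apply: hd0 => i; rewrite mxE cabsM.
    have := cd i; rewrite mxE subr0; apply: le_lt_trans.
    by rewrite ler_piMl // cabs_ge0.
  have [|M M0 hM] := disc_bounded (@N_ge0 n) (@N_eq0 n) (@NZ n) (@ND n) (ler01 : 0 <= 1 :> R)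
    (g := fun t => f (Y + scmx t (lincomb c Zs)) : E n).
    by move=> z /oc; exact: slice_pexp3.
  have fM t : cabs t = 1 -> nrm (f (Y + scmx t (lincomb c Zs))) <= M.
    by move=> t1; apply: hM; rewrite t1.
  exists M => l; have [h _] := slice_estimates ltr01 oc fM.
  by have := h l; rewrite expr1n divr1.
have [c0 [d dp [M hM]]] := baire_bounded d00 Pc Pb.
have M0 : 0 <= M.
  apply: le_trans (hM c0 _ 0%N); first exact: N_ge0.
  by move=> i; rewrite subrr cabs0.
exists d => //; exists M => // c cd l.
have q3 s : pexp3 (NE n) (fun s => P l (c + s *: c0)) s.
  have [a ha] := DeltaR_line_pexp Om_nc Om_open nrm_adm f_nc f_bdd
    (lincomb c Zs) (lincomb c0 Zs) l s oY.
  have -> : (fun s => P l (c + s *: c0)) =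
      (fun s => DeltaR Om f Y (lincomb c Zs + scmx s (lincomb c0 Zs)) l).
    by apply/funext => u; rewrite /P lincombD lincombZ.
  exact: pexp_pexp3 ha.
have := max_modulus (@N_ge0 n) (@N_eq0 n) (@NZ n) (@ND n) (M := M) ltr01 (fun z _ => q3 z).
move=> h; have {h} := h _ 0; rewrite cabs0 scale0r addr0; apply; last exact: ler01.
move=> s s1; have s0 : s != 0 by rewrite -cabs_gt0 s1.
(* For |s| = 1 the point c + s c0 is a rotation of a point of the ball about c0, and homogeneity
   removes the rotation. *)
have -> : c + s *: c0 = s *: (c0 + s^-1 *: c).
  by rewrite scalerDr scalerA divff // scale1r addrC.
rewrite /P lincombZ (DeltaR_homogeneous Om_nc Om_open nrm_adm f_nc f_bdd) //.
rewrite (nrmZ nrm_adm) cabsX s1 expr1n mul1r; apply: hM => i.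
rewrite !mxE addrAC subrr add0r cabsM cabsV s1 invr1 mul1r.
by have := cd i; rewrite mxE subr0.
Qed.

(** Write c = x c' with c' in a polydisc where all coefficients are bounded by M. The terms of
    positive degree then sum to at most M x / (1 - x) <= 2 M x <= e / 2, and for fixed c' the Taylor
    remainder is below e / 2 at a suitable order. *)
Lemma nc_continuous n (Y : 'M[V]_n) k (Zs : 'I_k -> 'M[V]_n) (e : R) :
  Om Y -> 0 < e -> exists2 d : R, 0 < d & forall c : 'rV[C]_k,
    (forall i, cabs (c 0 i) < d) ->
    Om (Y + lincomb c Zs) /\ nrm (f (Y + lincomb c Zs) - f Y) < e.
Proof.
move=> oY e0; have [d0 d00 hd0] := fin_open_near Zs (@Om_open _) oY.
have [d1 d10 [M M0 hM]] := DeltaR_bounded_near Zs oY.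
pose x := Num.min 2^-1 (e / (8 * (M + 1))).
have M1 : 0 < 8 * (M + 1) by lra.
have x0 : 0 < x by rewrite lt_min invr_gt0 ltr0n divr_gt0.
have x2 : x <= 2^-1 by rewrite ge_min lexx.
have xM : x * (8 * (M + 1)) <= e.
  by rewrite -ler_pdivlMr // ge_min lexx orbT.
pose d2 := Num.min d0 d1; have d20 : 0 < d2 by rewrite lt_min d00.
exists (x * d2); first by rewrite mulr_gt0.
move=> c hc; pose c' := (x%:C%C)^-1 *: c.
have cx : cabs x%:C%C = x by rewrite cabs_real gtr0_norm.
have xC0 : x%:C%C != 0 :> C by rewrite -cabs_gt0 cx.
have ec : c = x%:C%C *: c' by rewrite scalerA divff // scale1r.
have hc' i : cabs (c' 0 i) < d2.
  by rewrite mxE cabsM cabsV cx ltr_pdivrMl.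
have [hc0 hc1] : (forall i, cabs (c' 0 i) < d0) /\ near_row d1 0 c'.
  split=> i; have := hc' i; rewrite lt_min => /andP[] //.
  by rewrite [(0 : 'rV__) 0 i]mxE subr0.
have oc t : cabs t <= 1 -> Om (Y + scmx t (lincomb c' Zs)).
  move=> t1; rewrite -lincombZ; apply: hd0 => i; rewrite mxE cabsM.
  by apply: le_lt_trans (hc0 i); rewrite ler_piMl // cabs_ge0.
(* This bound depends on c', but it only influences the order n0 of the Taylor polynomial, and M is
   independent of that order. *)
have [|M' M'0 hM'] := disc_bounded (@N_ge0 n) (@N_eq0 n) (@NZ n) (@ND n) (ler01 : 0 <= 1 :> R)
    (g := fun t => f (Y + scmx t (lincomb c' Zs)) : E n).
  by move=> z /oc; exact: slice_pexp3.
have fM t : cabs t = 1 -> nrm (f (Y + scmx t (lincomb c' Zs))) <= M'.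
  by move=> t1; apply: hM'; rewrite t1.
have [_ h] := slice_estimates ltr01 oc fM.
have xx : cabs x%:C%C <= 1 by rewrite cx; lra.
split; first by rewrite ec lincombZ; exact: oc.
have x01 : 0 <= x < 1 by apply/andP; split; lra.
have e20 : 0 < e / 2 by rewrite divr_gt0.
have [n0 hn0] := linear_geometric_cvg M' x01 e20.
have := h n0.+1 _ xx; rewrite cx divr1 -lincombZ -ec => h1.
have {}h1 := le_lt_trans h1 (hn0 _ (leqnSn n0)).
move: h1; rewrite big_ord_recl expr0 scmx1.
have <- : f Y = DeltaR Om f Y (lincomb c' Zs) 0.
  have := pexp_at0 (@N_ge0 n) (@N_eq0 n)
    (slice_pexp0 Om_nc Om_open nrm_adm f_nc f_bdd (lincomb c' Zs) oY).
  by rewrite scmx0l addr0.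
set F := f (Y + _); set S := \sum_(_ < _) _ => h1.
have -> : F - f Y = (F - (f Y + S)) + S by rewrite opprD !addrA subrK.
have hS : nrm S <= 2 * M * x.
  apply: le_trans (N_sum (@NZ n) (@ND n) _ _ _) _.
  apply: (@le_trans _ _ (\sum_(l < n0) M * x * x ^+ l)).
    apply: ler_sum => l _; rewrite (nrmZ nrm_adm) cabsX cx lift0 exprS.
    rewrite mulrC -mulrA ler_wpM2r ?mulr_ge0 ?exprn_ge0 ?(ltW x0) //.
    exact: hM.
  rewrite -mulr_sumr mulrC; apply: (@le_trans _ _ (2 * (M * x))); last by rewrite mulrA.
  rewrite ler_wpM2r ?mulr_ge0 ?(ltW x0) // (le_trans (geometric_le _ x01)) //.
  by rewrite -[leRHS]invrK lef_pV2 ?posrE ?invr_gt0 // ?subr_gt0; lra.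
apply: le_lt_trans (nrmD nrm_adm _ _) _; rewrite (splitr e) ltr_leD //.
apply: (le_trans hS); nra.
Qed.

(* Y + t (X' - Y) - (Y + t0 (X - Y)) = (t0 - t) Y + t X' - t0 X *)
Lemma nc_continuous_slices n (Y : 'M[V]_n) k (Zs : 'I_k -> 'M[V]_n)
    (c : 'rV[C]_k) (t0 : C) (e : R) :
  Om (Y + scmx t0 (lincomb c Zs - Y)) -> 0 < e ->
  exists2 d : R, 0 < d & forall (c' : 'rV[C]_k) t, near_row d c c' ->
    cabs (t - t0) < d ->
    Om (Y + scmx t (lincomb c' Zs - Y)) /\
    nrm (f (Y + scmx t (lincomb c' Zs - Y)) -
         f (Y + scmx t0 (lincomb c Zs - Y))) < e.
Proof.
move=> oX e0; set X := Y + _ in oX *.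
have [d dp hd] := nc_continuous (consfam Y Zs) oX e0.
(* The coefficient t c'_j - t0 c_j is at most |t| |c'_j - c_j| + |t - t0| |c_j|. With |t| <= |t0| +
   1 this stays below A (d / A) = d. *)
pose A := cabs t0 + 2 + \sum_i cabs (c 0 i).
have A1 : 1 < A.
  have := cabs_ge0 t0; have : 0 <= \sum_i cabs (c 0 i) by apply: sumr_ge0 => i _; exact: cabs_ge0.
  by rewrite /A; lra.
have A0 : 0 < A by lra.
exists (Num.min 1 (d / A)); first by rewrite lt_min ltr01 divr_gt0.
move=> c' t hc' ht.
have eX : Y + scmx t (lincomb c' Zs - Y) =
    X + lincomb (row_mx (const_mx (t0 - t)) (t *: c' - t0 *: c)) (consfam Y Zs).
  rewrite lincomb_cons mxE lincombD lincombZ -scaleNr lincombZ scmxNl /X.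
  rewrite !scmxD !scmxN scmxDl scmxNl -!addrA; congr (_ + _).
  by rewrite !addrA [RHS](ACl (5*4*(1*6)*(2*3))) /= subrr addNr !addr0.
move: ht; rewrite lt_min => /andP[ht1 htA].
rewrite eX; apply: hd => i; rewrite mxE.
have dA : d / A <= d by rewrite ler_pdivrMr // ler_peMr // ltW.
case: fintype.split => j; first by rewrite mxE cabs_distC (lt_le_trans htA).
rewrite !mxE.
have -> : t * c' 0 j + - (t0 * c 0 j) = t * (c' 0 j - c 0 j) + (t - t0) * c 0 j.
  by ring.
have := hc' j; rewrite lt_min => /andP[_ hj].
apply: le_lt_trans (cabsD _ _) _; rewrite !cabsM.
have t1 : cabs t <= cabs t0 + 1.
  have -> : t = t0 + (t - t0) by rewrite addrC subrK.
  by rewrite (le_trans (cabsD _ _)) // lerD2l ltW.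
have cj : cabs (c 0 j) <= \sum_i cabs (c 0 i).
  by rewrite (bigD1 j) //= lerDl sumr_ge0 // => i' _; exact: cabs_ge0.
have -> : d = (d / A) * A by rewrite divfK // gt_eqF.
set x := d / A in hj htA dA *; have x0 : 0 < x by rewrite divr_gt0.
have := cabs_ge0 (c 0 j); have := cabs_ge0 t.
have := cabs_ge0 (c' 0 j - c 0 j); have := cabs_ge0 (t - t0).
move: hj htA t1 cj; rewrite /A.
set y := cabs (c' 0 j - c 0 j); set z := cabs (t - t0).
set u := cabs t; set v := cabs (c 0 j); set T := cabs t0; set S := \sum_i _.
move=> hj htA t1 cj z0 y0 u0 v0.
have h1 : u * y <= (T + 1) * x by rewrite ler_pM // ltW.
have h2 : z * v <= x * S by rewrite ler_pM // ltW.
rewrite !mulrDr; lra.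
Qed.

End NCContinuity.

(** * Derivatives, the set [Ups] and convergence of the series *)

Section Conclusions.
Context {R : realType} {V : lmodType R[i]} {W : normedModType R[i]}
  {nrm : forall n, 'M[W]_n -> R} {Om : forall n, set 'M[V]_n}
  {f : forall n, 'M[V]_n -> 'M[W]_n}.
Local Notation C := R[i].
Hypotheses (Om_nc : nc_set Om) (Om_open : fin_open Om) (nrm_adm : admissible nrm)
  (f_nc : nc_fun Om f) (f_bdd : loc_bdd_slices Om nrm f).
Local Notation E n := (modmx W n).
Local Notation NE n := (@nrm n : E n -> R).

Let N_ge0 n (x : E n) : 0 <= NE n x. Proof. exact: nrm_ge0. Qed.
Let N_eq0 n (x : E n) : NE n x = 0 -> x = 0. Proof. exact: nrm_eq0. Qed.
Let NZ n (c : C) (x : E n) : NE n (c *: x) = cabs c * NE n x.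
Proof. exact: nrmZ. Qed.
Let ND n (x y : E n) : NE n (x + y) <= NE n x + NE n y.
Proof. exact: nrmD. Qed.

Lemma mlim_of_quadratic n (G : C -> 'M[W]_n) (x L : 'M[W]_n) (d K : R) :
  0 < d -> 0 <= K ->
  (forall h, cabs h < d -> nrm (G h - x - scmx h L) <= K * cabs h ^+ 2) ->
  mlim (@nrm n) (fun h => scmx h^-1 (G h - x)) L.
Proof.
move=> d0 K0 hG e e0; have K1 : 0 < K + 1 by rewrite ltr_wpDl.
exists (Num.min d (e / (K + 1))); first by rewrite lt_min d0 divr_gt0.
move=> h /andP[h0]; rewrite lt_min => /andP[/hG hd]; rewrite ltr_pdivlMr // => he.
have hn : h != 0 by rewrite -cabs_gt0.
have -> : scmx h^-1 (G h - x) - L = scmx h^-1 (G h - x - scmx h L).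
  by rewrite [RHS]scmxD scmxN scmxA mulVf // scmx1.
rewrite (nrmZ nrm_adm) cabsV ltr_pdivrMl //.
by apply: (le_lt_trans hd); nra.
Qed.

Lemma nc_G_diff : G_diff Om nrm f.
Proof.
move=> n X Z oX; exists (DeltaR Om f X Z 1).
have [d d0 [K K0 hK]] := slice_pexp0 Om_nc Om_open nrm_adm f_nc f_bdd Z oX 2.
apply: (mlim_of_quadratic d0 K0) => h /hK; rewrite add0r.
rewrite !big_ord_recr big_ord0 /= add0r expr0 expr1 scale1r opprD addrA.
have <- // : f X = DeltaR Om f X Z 0.
have := pexp_at0 (@N_ge0 n) (@N_eq0 n)
    (slice_pexp0 Om_nc Om_open nrm_adm f_nc f_bdd Z oX).
by rewrite scmx0l addr0.
Qed.

(** The derivatives are j! times the coefficients at Y + tZ: by [pexp_deriv] the coefficient of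
    index j has derivative j+1 times the one of index j+1. *)
Lemma nc_nth_deriv n (Y Z : 'M[V]_n) (N : nat) : Om Y ->
  exists d : 'M[W]_n,
    nth_deriv_at (@nrm n) (fun t => f (Y + scmx t Z)) N 0 d /\
    scmx (N`!%:R)^-1 d = DeltaR Om f Y Z N.
Proof.
move=> oY; have [r r0 oYZ] := fin_open_line Z (@Om_open _) oY.
pose a (t : C) j : E n := DeltaR Om f (Y + scmx t Z) Z j.
(* For j = 0 the slice itself is taken: [D 0] must equal it at every t, also where Y + tZ leaves
   [Om]. *)
pose D j (t : C) : 'M[W]_n := if j is 0 then f (Y + scmx t Z) else
  scmx (j`!%:R) (a t j).
have DE j t : cabs t < r -> D j t = scmx (j`!%:R) (a t j).
  move=> tr; case: j => [|//]; rewrite fact0 scmx1.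
  exact: (pexp_at0 (@N_ge0 n) (@N_eq0 n)
    (slice_pexp Om_nc Om_open nrm_adm f_nc f_bdd (oYZ _ tr))).
have Dd j t : cabs t < r -> has_deriv (@nrm n) (D j) t (D j.+1 t).
  move=> tr; have r1 : 0 < (r - cabs t) / 2 by rewrite divr_gt0 // subr_gt0.
  have near h : cabs h <= (r - cabs t) / 2 -> cabs (t + h) < r.
    by move=> hr; apply: le_lt_trans (cabsD _ _) _; lra.
  have [d d0 [K K0 hK]] := pexp_deriv (@N_ge0 n) (@N_eq0 n) (@NZ n) (@ND n) j
    (g := fun h => f (Y + scmx (t + h) Z) : E n) (a := fun h => a (t + h)) r1
    (fun h hr => pexp_translate (slice_pexp Om_nc Om_open nrm_adm f_nc f_bdd
        (oYZ _ (near h hr)))).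
  apply: (@mlim_of_quadratic n (fun h => D j (t + h)) (D j t) (D j.+1 t)
    (Num.min d ((r - cabs t) / 2)) (j`!%:R * K)).
  - by rewrite lt_min d0.
  - by rewrite mulr_ge0.
  move=> h; rewrite lt_min => /andP[/hK hd /ltW/near hr].
  rewrite !DE // factS addr0 in hd *.
  have -> : scmx j`!%:R (a (t + h) j) - scmx j`!%:R (a t j) -
      scmx h (scmx (j.+1 * j`!)%:R (a t j.+1)) =
    scmx j`!%:R (a (t + h) j - a t j - scmx h (scmx j.+1%:R (a t j.+1))).
    rewrite [RHS]scmxD [scmx _ (_ - _)]scmxD !scmxN !scmxA natrM.
    by congr (_ - scmx _ _); ring.
  by rewrite (nrmZ nrm_adm) cabs_nat -mulrA ler_wpM2l.
exists (D N 0); split.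
  exists D; split=> //; last by case: N => [//|N] _; apply: Dd; rewrite cabs0.
  by exists r => // j t _; rewrite subr0; exact: Dd.
by rewrite DE ?cabs0 // scmxA mulVf ?scmx1 /a ?scmx0l ?addr0 // pnatr_eq0 -lt0n fact_gt0.
Qed.

Lemma Ups_compl_circ n (Y : 'M[V]_n) : compl_circ Y (Ups Om Y).
Proof.
move=> X [oX hX] t t1; split; first exact: hX.
move=> s s1; rewrite [Y + scmx t _]addrC addrK scmxA; apply: hX.
by rewrite cabsM mulr_ile1 ?cabs_ge0.
Qed.

Lemma Ups_max n (Y : 'M[V]_n) (U : set 'M[V]_n) :
  compl_circ Y U -> U `<=` @Om n -> U `<=` Ups Om Y.
Proof. by move=> cU UO X UX; split=> [|t t1]; apply: UO => //; exact: cU. Qed.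

(* The neighbourhoods exhausting Ups Om Y; the bound s^-1 makes the family
   increase as s decreases to 0. *)
Definition Ups_level n (Y : 'M[V]_n) (s : R) : set 'M[V]_n :=
  [set X | forall t : C, cabs t <= 1 + s -> Om (Y + scmx t (X - Y)) /\
     nrm (f (Y + scmx t (X - Y))) < s^-1].

(** Compactness of the closed unit disc gives one radius for all its points. A point t with |t| <= 1
    + s lies within s of its radial retraction t / (1 + s), so the disc of radius 1 + s is covered
    too. *)
Lemma Ups_level_near n (Y : 'M[V]_n) k (Zs : 'I_k -> 'M[V]_n) (c : 'rV[C]_k) :
  Ups Om Y (lincomb c Zs) -> exists2 s0 : R, 0 < s0 &
    forall c' s, near_row s0 c c' -> 0 < s < s0 ->
      Ups_level Y s (lincomb c' Zs).
Proof.
move=> [_ oX].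
pose P (s : R) (z : C) := forall (c' : 'rV[C]_k) t, near_row s c c' ->
  cabs (t - z) < 2 * s -> Om (Y + scmx t (lincomb c' Zs - Y)) /\
    nrm (f (Y + scmx t (lincomb c' Zs - Y))) < s^-1.
have [|s0 s00 hs0] := @disc_tube R 1 P.
  move=> z /oX oz; have [d d0 hd] :=
    nc_continuous_slices Om_nc Om_open nrm_adm f_nc f_bdd oz ltr01.
  pose B := nrm (f (Y + scmx z (lincomb c Zs - Y))) + 1.
  have B0 : 0 < B by rewrite ltr_wpDl // (nrm_ge0 nrm_adm).
  (* With s < d / 3, the distance |t - z| is below 2 s + d / 3 <= d; with s < B^-1, the bound s^-1
     exceeds the norms near z. *)
  exists (Num.min (d / 3) B^-1); first by rewrite lt_min divr_gt0 // invr_gt0.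
  move=> w s; rewrite !lt_min => /andP[wz _] /and3P[sp sd sB] c' t cc' tw.
  have [||o1 h1] := hd c' t.
  - by move=> i; apply: lt_trans (cc' i) _; lra.
  - have := cabsD (t - w) (w - z); rewrite addrA subrK; lra.
  split=> //; apply: (@lt_trans _ _ B).
    set x := f _ in h1 *; set y := f _ in h1 B B0 sB *.
    have -> : x = y + (x - y) by rewrite addrC subrK.
    by rewrite (le_lt_trans (nrmD nrm_adm _ _)) // ltrD2l.
  by rewrite -[B]invrK ltf_pV2 ?posrE ?invr_gt0.
have u0 : 0 < s0 / 2 < s0 by apply/andP; split; lra.
exists (s0 / 2); first by case/andP: u0.
move=> c' s cc' /andP[sp su] t ts.
have s1 : 0 < 1 + s by lra.
have cs : cabs (1 + s)%:C%C = 1 + s by rewrite cabs_real gtr0_norm.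
have sn : (1 + s)%:C%C != 0 :> C by rewrite -cabs_gt0 cs.
pose z := t / (1 + s)%:C%C.
have z1 : cabs z <= 1.
  by rewrite cabsM cabsV cs ler_pdivrMr // mul1r.
have tz : cabs (t - z) < 2 * (s0 / 2).
  have -> : t - z = z * (s%:C%C).
    rewrite -[t in LHS](divfK sn) -/z -[X in _ - X]mulr1 -mulrBr; congr (_ * _).
    by rewrite rmorphD /= rmorph1 [1 + _]addrC addrK.
  rewrite cabsM cabs_real gtr0_norm //; apply: (@le_lt_trans _ _ s); last by lra.
  by rewrite ler_piMl // ltW.
have [h0 h1] := hs0 _ z u0 z1 c' t cc' tz; split=> //; apply: (lt_trans h1).
by rewrite ltf_pV2 ?posrE //; lra.
Qed.

Lemma Ups_fin_open n (Y : 'M[V]_n) : fin_open_set (Ups Om Y).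
Proof.
move=> k Zs; apply/open_rVP => c /Ups_level_near[s0 s00 h].
exists s0 => // c' cc'; have s2 : 0 < s0 / 2 < s0 by apply/andP; split; lra.
have hc := h c' _ cc' s2.
have oc t : cabs t <= 1 -> Om (Y + scmx t (lincomb c' Zs - Y)).
  by move=> t1; apply: (proj1 (hc t _)); lra.
split=> //; have := oc 1; rewrite cabs1 scmx1 addrC subrK; exact.
Qed.

(** In [Ups_level] the closed disc supplies compactness and the strict inequality on the norm
    supplies openness. *)
Lemma Ups_level_fin_open n (Y : 'M[V]_n) s : fin_open_set (Ups_level Y s).
Proof.
move=> k Zs; apply/open_rVP => c hc.
pose P (u : R) (z : C) := forall c' : 'rV[C]_k, near_row u c c' ->
  Om (Y + scmx z (lincomb c' Zs - Y)) /\
    nrm (f (Y + scmx z (lincomb c' Zs - Y))) < s^-1.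
have [|u u0 hu] := @disc_tube R (1 + s) P.
  move=> z /hc[oz fz]; set X := Y + _ in oz fz.
  have e0 : 0 < s^-1 - nrm (f X) by rewrite subr_gt0.
  have [d d0 hd] := nc_continuous_slices Om_nc Om_open nrm_adm f_nc f_bdd oz e0.
  exists d => // w v wz /andP[v0 vd] c' cc'.
  have [|o1 h1] := hd c' w _ wz; first by move=> i; apply: lt_trans (cc' i) _.
  split=> //; set x := f _ in h1 *; rewrite -/X in h1; set y := f X in h1 e0 fz *.
  have -> : x = y + (x - y) by rewrite addrC subrK.
  by apply: le_lt_trans (nrmD nrm_adm _ _) _; lra.
exists (u / 2); first by rewrite divr_gt0.
by move=> c' cc' t ts; apply: (hu (u / 2)) => //; apply/andP; split; lra.
Qed.

Lemma Ups_level_compl_circ n (Y : 'M[V]_n) s : compl_circ Y (Ups_level Y s).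
Proof.
move=> X hX t t1 u us; rewrite [Y + scmx t _]addrC addrK scmxA; apply: hX.
by rewrite cabsM (le_trans _ us) // ler_piMr // cabs_ge0.
Qed.

Lemma Ups_level_sub n (Y : 'M[V]_n) s : 0 < s -> Ups_level Y s `<=` Ups Om Y.
Proof.
move=> s0 X hX; have oc t : cabs t <= 1 -> Om (Y + scmx t (X - Y)).
  by move=> t1; apply: (proj1 (hX t _)); lra.
split=> //; have := oc 1; rewrite cabs1 scmx1 addrC subrK; exact.
Qed.

(** The slice estimates on the disc of radius 1 + s, read at t = 1. Ratio and constants depend on s
    alone, so they are uniform over the level. *)
Lemma Ups_level_estimates n (Y X : 'M[V]_n) s : 0 < s -> Ups_level Y s X ->
  (forall l, nrm (DeltaR Om f Y (X - Y) l) <= s^-1 * (1 + s)^-1 ^+ l) /\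
  (forall L, nrm (\sum_(l < L) DeltaR Om f Y (X - Y) l - f X)
       <= L.+1%:R * s^-1 * (1 + s)^-1 ^+ L).
Proof.
move=> s0 hX; have s1 : 0 < 1 + s by lra.
have [|t ts|h1 h2] := @slice_estimates _ _ _ _ _ _ Om_nc Om_open nrm_adm f_nc f_bdd
    n Y (X - Y) (1 + s) s^-1 s1.
- by move=> t /hX[].
- by apply/ltW/(proj2 (hX t _)); rewrite ts.
split=> [l|L]; first by rewrite exprVn; exact: h1.
have := h2 L 1; rewrite cabs1 div1r scmx1 [Y + _]addrC subrK => h.
rewrite -(N_distC (@NZ n)); apply: le_trans (h _); last by lra.
rewrite le_eqVlt; apply/orP; left; apply/eqP; congr nrm; congr (_ - _).
by apply: eq_bigr => l _; rewrite expr1n scmx1.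
Qed.

Lemma geometric_series_fin (u : nat -> \bar R) (M x : R) : 0 <= x < 1 -> 0 <= M ->
  (forall l, (0 <= u l <= (M * x ^+ l)%:E)%E) ->
  (\sum_(0 <= l <oo) u l < +oo)%E.
Proof.
move=> x01 M0 hu; apply: (@le_lt_trans _ _ (M * (1 - x)^-1)%:E); last exact: ltry.
apply: lime_le.
  by apply: is_cvg_nneseries => l _ _; have /andP[] := hu l.
apply: nearW => n; apply: (@le_trans _ _ (\sum_(0 <= l < n) (M * x ^+ l)%:E)%E).
  by apply: lee_sum => l _; have /andP[] := hu l.
rewrite sumEFin lee_fin -mulr_sumr ler_wpM2l // big_mkord.
exact: geometric_le.
Qed.

Lemma inv1s_lt1 (s : R) : 0 < s -> 0 <= (1 + s)^-1 < 1.
Proof.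
move=> s0; have s1 : 0 < 1 + s by lra.
by rewrite invr_ge0 (ltW s1) /= invf_lt1 //; lra.
Qed.

Lemma Ups_series n (Y X : 'M[V]_n) : Ups Om Y X ->
  (\sum_(0 <= l <oo) (nrm (DeltaR Om f Y (X - Y) l))%:E < +oo)%E /\
  series_to (@nrm n) (fun l => DeltaR Om f Y (X - Y) l) (f X).
Proof.
(* X is viewed as the point with coefficient 1 in the span of X alone. *)
move=> UX; have := @Ups_level_near n Y 1 (fun=> X) (const_mx 1).
rewrite /lincomb big_ord1 mxE scmx1 => /(_ UX)[s0 s00 h].
pose s := s0 / 2; have s2 : 0 < s < s0 by rewrite /s; apply/andP; split; lra.
have sp : 0 < s by case/andP: s2.
have := h (const_mx 1) s _ s2; rewrite big_ord1 mxE scmx1 => {}h.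
have {}h : Ups_level Y s X by apply: h => i; rewrite subrr cabs0.
have [h1 h2] := Ups_level_estimates sp h; have x01 := inv1s_lt1 sp.
split.
  apply: (geometric_series_fin x01 (M := s^-1)); first by rewrite invr_ge0 ltW.
  by move=> l; rewrite !lee_fin (nrm_ge0 nrm_adm) h1.
move=> e e0; have [n0 hn0] := linear_geometric_cvg s^-1 x01 e0.
by exists n0 => m /hn0; apply: le_lt_trans.
Qed.

Lemma Ups_compact_series n (Y : 'M[V]_n) k (Zs : 'I_k -> 'M[V]_n)
    (Kc : set 'rV[C^o]_k) : Om Y -> compact Kc ->
  (forall c, Kc c -> Ups Om Y (lincomb c Zs)) ->
  series_unif_to (@nrm n) (fun l X => DeltaR Om f Y (X - Y) l) (@f n)
    [set lincomb c Zs | c in Kc] /\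
  exists UK : set 'M[V]_n,
    [/\ fin_open_set UK, compl_circ Y UK,
        [set lincomb c Zs | c in Kc] `<=` UK, UK `<=` Ups Om Y
      & (\sum_(0 <= l <oo)
           ereal_sup [set (nrm (DeltaR Om f Y (X - Y) l))%:E | X in UK] < +oo)%E].
Proof.
move=> oY cK KU.
have [s0 s00 hs0] := @compact_tube R _ Kc (fun s c => Ups_level Y s (lincomb c Zs)) cK
  (fun c Kcc => let: ex_intro2 s0 s00 h := Ups_level_near (KU c Kcc) in
     ex_intro2 _ _ _ (proj2 (nbhs_rVP _ _) (ex_intro2 _ _ s0 s00 (fun c' => id)))
       (ex_intro2 _ _ s0 s00 h)).
pose B := nrm (f Y) + 1.
have B0 : 0 < B by rewrite ltr_wpDl // (nrm_ge0 nrm_adm).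
(* The bound B^-1 puts Y into [Ups_level Y s]; the suprema are then over a nonempty set, hence
   nonnegative, even when [Kc] is empty. *)
pose s := Num.min (s0 / 2) B^-1.
have sp : 0 < s by rewrite lt_min divr_gt0 //= invr_gt0.
have ss0 : 0 < s < s0.
  rewrite sp; apply: (@le_lt_trans _ _ (s0 / 2)); last by lra.
  by rewrite ge_min lexx.
have KL : [set lincomb c Zs | c in Kc] `<=` Ups_level Y s.
  by move=> _ [c Kcc <-]; exact: hs0.
have YL : Ups_level Y s Y.
  move=> t _; rewrite subrr scmx0 addr0; split=> //; apply: (@lt_le_trans _ _ B).
    by rewrite ltrDl.
  by rewrite -[B]invrK lef_pV2 ?posrE ?invr_gt0 // ge_min lexx orbT.
have x01 := inv1s_lt1 sp; split.
  move=> e e0; have [n0 hn0] := linear_geometric_cvg s^-1 x01 e0.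
  exists n0 => m /hn0 hm X /KL /(Ups_level_estimates sp)[_ h2].
  exact: le_lt_trans (h2 m) hm.
exists (Ups_level Y s); split=> //.
- exact: Ups_level_fin_open.
- exact: Ups_level_compl_circ.
- exact: Ups_level_sub.
apply: (geometric_series_fin x01 (M := s^-1)); first by rewrite invr_ge0 ltW.
move=> l; apply/andP; split.
  apply: (@le_trans _ _ (nrm (DeltaR Om f Y (Y - Y) l))%:E).
    by rewrite lee_fin (nrm_ge0 nrm_adm).
  by apply: ereal_sup_ubound; exists Y.
apply: ge_ereal_sup => _ [X /(Ups_level_estimates sp)[h1 _] <-].
by rewrite lee_fin.
Qed.

End Conclusions.

Theorem theorem7p2 (R : realType) (V : lmodType R[i])
  (W : completeNormedModType R[i]) (nrm : forall n, 'M[W]_n -> R)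
  (Om : forall n, set 'M[V]_n) (f : forall n, 'M[V]_n -> 'M[W]_n) :
  nc_set Om -> fin_open Om -> admissible nrm -> nc_fun Om f ->
  loc_bdd_slices Om nrm f ->
  [/\ (* (1) *)
      G_diff Om nrm f,
      (* (2) *)
      (forall n (Y Z : 'M[V]_n) (N : nat), Om n Y ->
         exists d : 'M[W]_n,
           nth_deriv_at (nrm n) (fun t => f n (Y + scmx t Z)) N 0 d /\
           scmx (N`!%:R)^-1 d = DeltaR Om f Y Z N),
      (* (3) *)
      (forall n (Y : 'M[V]_n), Om n Y ->
         [/\ compl_circ Y (Ups Om Y), Ups Om Y `<=` Om n,
             (forall U : set 'M[V]_n, compl_circ Y U -> U `<=` Om n ->
                U `<=` Ups Om Y),
             fin_open_set (Ups Om Y)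
           & forall X, Ups Om Y X ->
               (\sum_(0 <= l <oo) (nrm n (DeltaR Om f Y (X - Y) l))%:E < +oo)%E
               /\ series_to (nrm n) (fun l => DeltaR Om f Y (X - Y) l) (f n X)])
    & (* (4) *)
      (forall n (Y : 'M[V]_n), Om n Y ->
         forall (k : nat) (Zs : 'I_k -> 'M[V]_n) (Kc : set 'rV[R[i]^o]_k),
           compact Kc -> (forall c, Kc c -> Ups Om Y (lincomb c Zs)) ->
           series_unif_to (nrm n) (fun l X => DeltaR Om f Y (X - Y) l) (f n)
             [set lincomb c Zs | c in Kc] /\
           exists UK : set 'M[V]_n,
             [/\ fin_open_set UK, compl_circ Y UK,
                 [set lincomb c Zs | c in Kc] `<=` UK, UK `<=` Ups Om Y
               & (\sum_(0 <= l <oo)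
                    ereal_sup [set (nrm n (DeltaR Om f Y (X - Y) l))%:E
                              | X in UK] < +oo)%E])].
Proof.
move=> Om_nc Om_open nrm_adm f_nc f_bdd; split.
- exact: nc_G_diff.
- by move=> n Y Z N; exact: nc_nth_deriv.
- move=> n Y oY; split.
  + exact: Ups_compl_circ.
  + by move=> X [].
  + exact: Ups_max.
  + exact: (Ups_fin_open Om_nc Om_open nrm_adm f_nc f_bdd).
  + by move=> X; exact: Ups_series.
- by move=> n Y oY k Zs Kc; exact: Ups_compact_series.
Qed.
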